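(* For every knot type $[K]$, $e_{sh}[K] < e_L[K]$, where $e_L[K]$ and $e_{sh}[K]$ are the (minimal) edge lengths of $[K]$ in the cubic lattice and in the simple hexagonal lattice, respectively.
   Context: The cubic lattice is the point lattice $\mathbb{Z}^3\subset\mathbb{R}^3$ with basis $x=\langle 1,0,0\rangle$, $y=\langle 0,1,0\rangle$, $z=\langle 0,0,1\rangle$. The simple hexagonal lattice (sh-lattice) is the set of integer combinations of $x=\langle 1,0,0\rangle$, $y=\langle \tfrac12,\tfrac{\sqrt3}{2},0\rangle$, $w=\langle 0,0,1\rangle$; in the sh-lattice one also sets $z=y-x=\langle -\tfrac12,\tfrac{\sqrt3}{2},0\rangle$. An edge is a unit-length segment joining two lattice points that differ by $\pm x,\pm y,\pm z$ in the cubic lattice, or by $\pm x,\pm y,\pm z,\pm w$ in the sh-lattice. A polygon (lattice knot) in one of these lattices is a non-self-intersecting closed polygonal path made of edges of that lattice. The edge length of a polygon is its total number of edges. $e_L[K]$ (respectively $e_{sh}[K]$) is the minimum edge length over all polygons in the cubic lattice (respectively sh-lattice) representing the knot type $[K]$. Knot types include the unknot. *)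

(* Defs.v *)
From mathcomp Require Import all_boot all_order all_algebra.
From mathcomp Require Import all_classical all_reals all_analysis.

Set Implicit Arguments.
Unset Strict Implicit.
Unset Printing Implicit Defensive.

Import Order.TTheory GRing.Theory Num.Theory.
Import numFieldNormedType.Exports.

Local Open Scope classical_set_scope.
Local Open Scope ring_scope.

(* Points of R^3 are row vectors; the topology of 'rV[R]_3 is given by the sup
   norm. *)
Definition vec3 (R : realType) (a b c : R) : 'rV[R]_3 :=
  \row_i [:: a; b; c]`_i.

(** Polygons *)

(* A closed polygonal path is the cyclic sequence s of its vertices; its i-th
   edge joins the i-th vertex to the next one, the successor of the last vertex
   being the first one. *)
Definition vertex (R : realType) (s : seq 'rV[R]_3) (i : nat) : 'rV[R]_3 :=
  nth 0 s (i %% size s).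

Definition edge_point (R : realType) (s : seq 'rV[R]_3) (i : nat) (u : R) :
    'rV[R]_3 :=
  (1 - u) *: vertex s i + u *: vertex s i.+1.

Definition carrier (R : realType) (s : seq 'rV[R]_3) : set 'rV[R]_3 :=
  [set p | exists i u, [/\ (i < size s)%N, 0 <= u <= 1 & p = edge_point s i u]].

(* The path is traversed injectively. Each edge is taken without its final
   vertex, which is the initial vertex of the next edge. *)
Definition simple_polygon (R : realType) (s : seq 'rV[R]_3) : Prop :=
  (2 < size s)%N /\
  forall (i j : nat) (u v : R),
    (i < size s)%N -> (j < size s)%N -> 0 <= u < 1 -> 0 <= v < 1 ->
    edge_point s i u = edge_point s j v -> i = j /\ u = v.

(** Knot types *)

Definition homeomorphism (T : topologicalType) (f : T -> T) : Prop :=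
  continuous f /\
  exists g : T -> T, [/\ continuous g, cancel f g & cancel g f].

Definition ambient_isotopic (R : realType) (A B : set 'rV[R]_3) : Prop :=
  exists H : 'rV[R]_3 * R -> 'rV[R]_3,
    [/\ {within [set: 'rV[R]_3] `*` `[0, 1], continuous H},
        forall t, 0 <= t <= 1 -> homeomorphism (fun p => H (p, t)),
        forall p, H (p, 0) = p
      & (fun p => H (p, 1)) @` A = B].

Definition tame_knot (R : realType) (K : set 'rV[R]_3) : Prop :=
  exists s : seq 'rV[R]_3, simple_polygon s /\ ambient_isotopic K (carrier s).

Definition knot_type (R : realType) (K : set 'rV[R]_3) : set (set 'rV[R]_3) :=
  [set K' | ambient_isotopic K K'].

(** Lattice polygons *)

Record lattice (R : realType) := Lattice {
  lattice_point : set 'rV[R]_3;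
  (* edge vectors, up to sign *)
  lattice_step : seq 'rV[R]_3
}.

Definition int_span (R : realType) (a b c : 'rV[R]_3) : set 'rV[R]_3 :=
  [set p | exists k l m : int, p = a *~ k + b *~ l + c *~ m].

Definition cubic_lattice (R : realType) : lattice R :=
  let x := vec3 1 0 0 in
  let y := vec3 0 1 0 in
  let z := vec3 0 0 1 in
  Lattice (int_span x y z) [:: x; y; z].

Definition sh_lattice (R : realType) : lattice R :=
  let x := vec3 1 0 0 in
  let y := vec3 (1 / 2) (Num.sqrt 3 / 2) 0 in
  let w := vec3 0 0 1 in
  let z := y - x in
  Lattice (int_span x y w) [:: x; y; z; w].

Definition lattice_edge (R : realType) (L : lattice R) (p q : 'rV[R]_3) : Prop :=
  [/\ lattice_point L p, lattice_point L q
    & exists2 d, d \in lattice_step L & q - p = d \/ q - p = - d].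

Definition lattice_polygon (R : realType) (L : lattice R) (s : seq 'rV[R]_3) :
    Prop :=
  simple_polygon s /\
  forall i, (i < size s)%N -> lattice_edge L (vertex s i) (vertex s i.+1).

(* Every edge of a lattice polygon is a single lattice edge (consecutive edges
   may be collinear), so the edge length is the number of vertices. *)
Definition edge_lengths (R : realType) (L : lattice R)
    (T : set (set 'rV[R]_3)) : set nat :=
  [set n | exists s, [/\ lattice_polygon L s, T (carrier s) & size s = n]].

(* n is the minimum edge length of the knot type T in L. As a relation, it
   gives no default value to a knot type without representative in L. *)
Definition min_edge_length (R : realType) (L : lattice R)
    (T : set (set 'rV[R]_3)) (n : nat) : Prop :=
  edge_lengths L T n /\ forall m, edge_lengths L T m -> (n <= m)%N.

(* Main.v *)
Require Import Defs.
From HB Require Import structures.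
From mathcomp Require Import all_boot all_order all_algebra.
From mathcomp Require Import all_classical all_reals all_analysis.
From mathcomp Require Import zify ring lra.

(** A cubic polygon is sent to a polygon of the simple hexagonal lattice with the
    same number of edges by a shear of the horizontal planes. A horizontal diagonal
    of a unit square, x - y or x + y according to the shear, is also sent to a
    lattice edge. A closed cubic polygon has a corner, which a rotation of the axes
    makes horizontal; replacing the two edges of this corner by the diagonal does
    not change the knot type, because no other lattice edge enters the half-square
    that is swept. So every cubic polygon gives a hexagonal polygon of the same type
    with one edge less (shorter_sh_polygon), and this applies to a shortest one.

    Minimal lengths exist once some cubic polygon represents the knot
    (cubic_polygon_isotopic). A simple polygon is made rectilinear by replacing
    its edges with fine zigzags, the vector of an edge being split first along the
    x-axis and then along the y-axis (zigzag_edge, axial_isotopic). Its vertices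
    are then rounded, it is scaled, and its edges are cut into unit edges.

    All isotopies come from one fact: a displacement of a subset of space that is
    k-Lipschitz with k < 1 extends to an ambient isotopy
    (lipschitz_perturbation_isotopic). A simple polygon is a bi-Lipschitz curve, so
    a small move of its vertices is such a displacement
    (simple_polygon_perturbation), and a supremum argument extends this to every
    polygon that moves linearly while remaining simple (polygon_motion). The moves
    that are needed are linear maps (linear_motion) and replacing an edge by the two
    other sides of a triangle (triangle_insert, triangle_remove). *)

Set Implicit Arguments.
Unset Strict Implicit.
Unset Printing Implicit Defensive.

Import Order.TTheory GRing.Theory Num.Theory.
Import numFieldNormedType.Exports.

Local Open Scope classical_set_scope.
Local Open Scope ring_scope.

(* Linear identities between vectors, checked one coordinate at a time. *)
Ltac vec_ring := apply/rowP => ?; rewrite !mxE; ring.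

(** * Small Lipschitz displacements are ambient isotopies *)

Lemma norm_coord (R : realType) (v : 'rV[R]_3) (i : 'I_3) : `|v 0 i| <= `|v|.
Proof.
rewrite [leRHS]/Num.Def.normr /= mx_normrE; apply/bigmax_geP; right => /=.
by exists (0, i).
Qed.

Lemma norm_le_coord (R : realType) (v : 'rV[R]_3) (c : R) :
  0 <= c -> (forall i, `|v 0 i| <= c) -> `|v| <= c.
Proof.
move=> c0 vc; rewrite [leLHS]/Num.Def.normr /= mx_normrE (bigmax_le _ c0) //=.
by case=> i j _ /=; rewrite (ord1 i).
Qed.

(** McShane's extension: the supremum over a in A of f a - k |x - a| is the least
    k-Lipschitz function above f. *)
Lemma lipschitz_extension_real (R : realType) (T : normedModType R)
    (A : set T) (f : T -> R) (k : R) : 0 <= k ->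
  (forall x y, A x -> A y -> `|f x - f y| <= k * `|x - y|) ->
  exists g : T -> R, (forall x, A x -> g x = f x) /\
    forall x y, `|g x - g y| <= k * `|x - y|.
Proof.
move=> k0 fA; have [[a0 Aa0]|/set0P] := pselect (A !=set0); last first.
  move=> /negP; rewrite negbK => /eqP A0; exists (fun=> 0); split.
    by move=> x; rewrite A0.
  by move=> x y; rewrite subrr normr0 mulr_ge0.
pose S x := [set f a - k * `|x - a| | a in A].
have Sub x y b : A b -> f b - k * `|x - b| <= f b - k * `|y - b| + k * `|x - y|.
  move=> Ab; have : `|y - b| <= `|x - y| + `|x - b|.
    by rewrite (distrC x y) (le_trans (ler_distD x y b)).
  by move=> /(ler_wpM2l k0); rewrite mulrDr; lra.
have hS x : has_sup (S x).
  split; first by exists (f a0 - k * `|x - a0|); exists a0.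
  exists (f a0 + k * `|x - a0|) => _ [a Aa <-].
  have := fA _ _ Aa Aa0; rewrite ler_norml => /andP[_].
  have : `|a - a0| <= `|x - a| + `|x - a0|.
    by rewrite (distrC x a) (le_trans (ler_distD x a a0)).
  by move=> /(ler_wpM2l k0); rewrite mulrDr; lra.
have Slip x y : sup (S x) - sup (S y) <= k * `|x - y|.
  rewrite lerBlDl; apply: ge_sup; first by exists (f a0 - k * `|x - a0|); exists a0.
  move=> _ [a Aa <-]; apply: (le_trans (Sub x y a Aa)).
  by rewrite lerD2r; apply: ub_le_sup; [have [] := hS y | exists a].
exists (fun x => sup (S x)); split=> [x Ax|x y].
  apply/eqP; rewrite eq_le; apply/andP; split.
    apply: ge_sup; first by exists (f a0 - k * `|x - a0|); exists a0.
    move=> _ [a Aa <-]; have := fA _ _ Aa Ax.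
    by rewrite (distrC x a) ler_norml => /andP[_]; lra.
  apply: ub_le_sup; first by have [] := hS x.
  by exists x => //; rewrite subrr normr0 mulr0 subr0.
rewrite ler_norml; apply/andP; split; last exact: Slip.
by rewrite lerNl opprB distrC Slip.
Qed.

(** For the sup norm the coordinates extend independently, with the same
    constant; this matters because only constants below 1 give homeomorphisms. *)
Lemma lipschitz_extension (R : realType) (A : set 'rV[R]_3)
    (f : 'rV[R]_3 -> 'rV[R]_3) (k : R) : 0 <= k ->
  (forall x y, A x -> A y -> `|f x - f y| <= k * `|x - y|) ->
  exists g : 'rV[R]_3 -> 'rV[R]_3, (forall x, A x -> g x = f x) /\
    forall x y, `|g x - g y| <= k * `|x - y|.
Proof.
move=> k0 fA.
have /choice[g gP] : forall i : 'I_3, exists g : 'rV[R]_3 -> R,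
    (forall x, A x -> g x = f x 0 i) /\
    forall x y, `|g x - g y| <= k * `|x - y|.
  move=> i; apply: lipschitz_extension_real => // x y Ax Ay.
  apply: le_trans (fA x y Ax Ay).
  by have := norm_coord (f x - f y) i; rewrite !mxE.
exists (fun x => \row_i g i x); split=> [x Ax|x y].
  by apply/rowP => i; rewrite mxE; have [-> //] := gP i.
apply: norm_le_coord => [|i]; first by rewrite mulr_ge0.
by rewrite !mxE; have [_] := gP i; apply.
Qed.

Lemma lipschitz_continuous (R : realType) (T U : normedModType R) (f : T -> U)
    (k : R) : (forall x y, `|f x - f y| <= k * `|x - y|) -> continuous f.
Proof.
move=> fk x; apply/cvgrPdist_le => e e0.
have k1 : 0 < `|k| + 1 by rewrite ltr_pwDr.
apply/nbhs_ballP; exists (e / (`|k| + 1)); first by rewrite /= divr_gt0.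
move=> y; rewrite -ball_normE /= ltr_pdivlMr // => /ltW; rewrite mulrC.
apply: le_trans; apply: (le_trans (fk _ _)).
by rewrite ler_wpM2r // (le_trans (ler_norm k)) // lerDl.
Qed.

HB.instance Definition _ (R : realType) (m n : nat) :=
  Uniform_isComplete.Build 'M[R]_(m, n) cauchy_cvg.

Lemma contraction_has_fixpoint (R : realType) (f : 'rV[R]_3 -> 'rV[R]_3)
    (k : R) : 0 <= k < 1 ->
  (forall x y, `|f x - f y| <= k * `|x - y|) -> exists p, p = f p.
Proof.
move=> /andP[k0 k1] fk.
have fT : {homo f : x / [set: 'rV[R]_3] x >-> [set: 'rV[R]_3] x} by [].
have [| | |p _ pf] := @banach_fixed_point R _ [set: 'rV[R]_3] (mkfun_fun fT).
- by exists (NngNum k0); split=> // -[x y] _; apply: fk.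
- exact: closedT.
- by exists 0.
by exists p.
Qed.

(** Solving x + g x = y amounts to finding a fixed point of x |-> y - g x, and
    id + g shrinks no distance by more than the factor 1 - k, so that its inverse
    is Lipschitz. *)
Lemma id_add_contraction_homeomorphism (R : realType)
    (g : 'rV[R]_3 -> 'rV[R]_3) (k : R) : 0 <= k < 1 ->
  (forall x y, `|g x - g y| <= k * `|x - y|) ->
  homeomorphism (fun p : 'rV[R]_3 => p + g p).
Proof.
move=> /andP[k0 k1] gk.
have expand x y : (1 - k) * `|x - y| <= `|(x + g x) - (y + g y)|.
  have : `|x - y| <= `|(x + g x) - (y + g y)| + `|g x - g y|.
    have -> : x - y = (x + g x - (y + g y)) + (g y - g x).
      by vec_ring.
    by rewrite (distrC (g x)) ler_normD.
  by have := gk x y; lra.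
have /choice[h hP] : forall y, exists x, x + g x = y.
  move=> y.
  have [||p pE] := @contraction_has_fixpoint R (fun x => y - g x) k.
  - by rewrite k0.
  - by move=> a b; rewrite opprB addrC addrA subrK distrC.
  by exists p; rewrite {1}pE subrK.
split; last exists h; last split.
- apply: (@lipschitz_continuous _ _ _ _ (1 + k)) => x y.
  rewrite /= opprD addrACA mulrDl mul1r.
  by rewrite (le_trans (ler_normD _ _)) // lerD2l.
- apply: (@lipschitz_continuous _ _ _ _ (1 - k)^-1) => x y.
  rewrite -ler_pdivrMl ?invr_gt0 ?subr_gt0 // invrK.
  by rewrite (le_trans (expand _ _)) // !hP.
- move=> x; apply/eqP; rewrite -subr_eq0 -normr_le0.
  have := expand (h (x + g x)) x; rewrite hP subrr normr0.
  by rewrite pmulr_rle0 // subr_gt0.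
- exact: hP.
Qed.

(** Once the displacement of A is extended to the whole space as a k-Lipschitz
    map g, the maps id + t g for t in [0, 1] are all homeomorphisms. This
    produces every ambient isotopy below. *)
Lemma lipschitz_perturbation_isotopic (R : realType) (A : set 'rV[R]_3)
    (f : 'rV[R]_3 -> 'rV[R]_3) (k : R) : 0 <= k < 1 ->
  (forall x y, A x -> A y -> `|(f x - x) - (f y - y)| <= k * `|x - y|) ->
  ambient_isotopic A (f @` A).
Proof.
move=> /andP[k0 k1] fA.
have [g [gA gk]] := lipschitz_extension k0 fA.
exists (fun pt : 'rV[R]_3 * R => pt.1 + pt.2 *: g pt.1); split.
- have gc := lipschitz_continuous gk.
  apply: continuous_subspaceT => -[p t]; apply: cvgD; first exact: cvg_fst.
  apply: cvgZ; first exact: cvg_snd.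
  by apply: continuous_comp; [exact: cvg_fst | exact: gc].
- move=> t /andP[t0 t1].
  apply: (@id_add_contraction_homeomorphism _ (fun p => t *: g p) k).
    by rewrite k0.
  move=> x y /=; rewrite -scalerBr normrZ ger0_norm //.
  apply: le_trans (gk x y).
  by rewrite ler_piMl.
- by move=> p /=; rewrite scale0r addr0.
- apply/seteqP; split=> [_ [x Ax <-] /=|_ [x Ax <-]].
    by exists x => //; rewrite scale1r gA // addrC subrK.
  by exists x => //=; rewrite scale1r gA // addrC subrK.
Qed.

(** The two isotopies are composed at each time instead of being run one after
    the other: joint continuity then needs no gluing. *)
Lemma ambient_isotopic_trans (R : realType) (A B C : set 'rV[R]_3) :
  ambient_isotopic A B -> ambient_isotopic B C -> ambient_isotopic A C.
Proof.
move=> [H1 [c1 h1 H10 <-]] [H2 [c2 h2 H20 <-]].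
exists (fun pt => H2 (H1 pt, pt.2)); split.
- move: c1 c2 => /subspace_continuousP c1 /subspace_continuousP c2.
  apply/subspace_continuousP => -[p t] [_ /= t01].
  move=> U /(c2 (H1 (p, t), t) (conj I t01)) [[V W] /= [nV nW] VW].
  have := c1 (p, t) (conj I t01) V nV.
  rewrite !nbhs_simpl /= /within /= => nH.
  have nt : \forall q \near (p, t), W q.2.
    exact: (@cvg_snd _ _ (nbhs p) (nbhs t)).
  near=> q => -[_ q01].
  apply: VW => //=; split=> //=; last by near: q.
  by have : [set: 'rV[R]_3] q.1 /\ q.2 \in `[0, 1] by []; near: q.
- move=> t t01; have [f1 [g1 [cg1 fg1 gf1]]] := h1 t t01.
  have [f2 [g2 [cg2 fg2 gf2]]] := h2 t t01.
  split.
    move=> x; exact: (@continuous_comp _ _ _ (fun p => H1 (p, t))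
      (fun p => H2 (p, t)) x (f1 x) (f2 _)).
  exists (g1 \o g2); split.
  + by move=> x; apply: continuous_comp; [exact: cg2 | exact: cg1].
  + by move=> x /=; rewrite fg2 fg1.
  + by move=> x /=; rewrite gf1 gf2.
- by move=> p /=; rewrite H10 H20.
- by rewrite image_comp.
Unshelve. all: by end_near. Qed.

(** A form of lipschitz_perturbation_isotopic for parametrized sets. The bound
    makes h i depend on g i only. *)
Lemma parametrized_isotopic (R : realType) (I : Type) (S : set I)
    (g h : I -> 'rV[R]_3) (k : R) : 0 <= k < 1 ->
  (forall i j, S i -> S j ->
     `|(h i - g i) - (h j - g j)| <= k * `|g i - g j|) ->
  ambient_isotopic (g @` S) (h @` S).
Proof.
move=> k01 gh.
have same i j : S i -> S j -> g i = g j -> h i = h j.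
  move=> Si Sj gij; have := gh i j Si Sj.
  rewrite gij subrr normr0 mulr0 normr_le0 opprB addrA subrK subr_eq0.
  by move/eqP.
have /choice[f fP] : forall x, exists y, forall i, S i -> g i = x -> y = h i.
  move=> x; have [[j Sj gj]|nj] := pselect (exists2 j, S j & g j = x).
    by exists (h j) => i Si gi; apply: same => //; rewrite gj gi.
  by exists 0 => i Si gi; case: nj; exists i.
have -> : h @` S = f @` (g @` S).
  apply/seteqP; split=> [_ [i Si <-]|_ [_ [i Si <-] <-]].
    by exists (g i); [exists i | apply: fP].
  by exists i => //; apply/esym/fP.
apply: (lipschitz_perturbation_isotopic k01) => _ _ [i Si <-] [j Sj <-].
by rewrite (fP _ i) // (fP _ j) //; apply: gh.
Qed.

Lemma ambient_isotopic_refl (R : realType) (A : set 'rV[R]_3) :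
  ambient_isotopic A A.
Proof.
have := @lipschitz_perturbation_isotopic R A id 0.
rewrite image_id; apply; first by rewrite lexx ltr01.
by move=> x y _ _; rewrite !subrr normr0 mul0r.
Qed.

Lemma segments_distance (R : realType) (a b c d : 'rV[R]_3) :
  (forall u v, 0 <= u <= 1 -> 0 <= v <= 1 ->
     (1 - u) *: a + u *: b <> (1 - v) *: c + v *: d) ->
  exists2 e, 0 < e & forall u v, 0 <= u <= 1 -> 0 <= v <= 1 ->
     e <= `|((1 - u) *: a + u *: b) - ((1 - v) *: c + v *: d)|.
Proof.
move=> dis.
pose f (x : R * R) :=
  `|((1 - x.1) *: a + x.1 *: b) - ((1 - x.2) *: c + x.2 *: d)|.
have cf : continuous f.
  have ct (T : topologicalType) (g : T -> R) (p q : 'rV[R]_3) : continuous g ->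
      continuous (fun x => (1 - g x) *: p + g x *: q).
    move=> cg x; apply: cvgD; apply: cvgZr_tmp; last exact: cg.
    by apply: cvgB; [exact: cvg_cst | exact: cg].
  by move=> x; apply: cvg_norm; apply: cvgB; apply: ct => y;
    [exact: cvg_fst | exact: cvg_snd].
have [| |x] := @compact_EVT_min _ _ f (`[0, 1] `*` `[0, 1]) _ _
    (continuous_subspaceT cf).
- by exists (0, 0); split; rewrite /= in_itv /= lexx ler01.
- by apply: compact_setX; exact: segment_compact.
rewrite inE => -[/= x1 x2] fmin; exists (f x).
  rewrite normr_gt0 subr_eq0; apply/eqP/dis.
    by move: x1; rewrite in_itv.
  by move: x2; rewrite in_itv.
move=> u v u01 v01; apply: (fmin (u, v)); rewrite inE.
by split; rewrite /= in_itv.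
Qed.

Lemma finite_uniform (R : realDomainType) (P : nat -> R -> Prop) (n : nat) :
  (forall i e e', P i e -> e' <= e -> P i e') ->
  (forall i, (i < n)%N -> exists2 e, 0 < e & P i e) ->
  exists2 e, 0 < e & forall i, (i < n)%N -> P i e.
Proof.
move=> mono; elim: n => [|n IH] Pn; first by exists 1.
have [|e e0 Pe] := IH; first by move=> i iltn; apply: Pn; rewrite ltnW.
have [e' e'0 Pe'] := Pn n (ltnSn n).
exists (Num.min e e'); first by rewrite lt_min e0.
move=> i; rewrite ltnS leq_eqVlt => /predU1P[->|/Pe Pi].
  by apply: mono Pe' _; rewrite ge_min lexx orbT.
by apply: mono Pi _; rewrite ge_min lexx.
Qed.

(** * Edges of simple polygons *)

Lemma vertex_mod (R : realType) (s : seq 'rV[R]_3) i :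
  vertex s (i %% size s) = vertex s i.
Proof. by rewrite /vertex modn_mod. Qed.

Lemma edge_point_mod (R : realType) (s : seq 'rV[R]_3) i u :
  edge_point s (i %% size s) u = edge_point s i u.
Proof.
rewrite /edge_point vertex_mod; congr (_ + _ *: _).
by rewrite /vertex -[in LHS](addn1 (i %% _)) modnDml addn1.
Qed.

Lemma edge_point0 (R : realType) (s : seq 'rV[R]_3) i :
  edge_point s i 0 = vertex s i.
Proof. by rewrite /edge_point subr0 scale1r scale0r addr0. Qed.

Lemma edge_point1 (R : realType) (s : seq 'rV[R]_3) i :
  edge_point s i 1 = vertex s i.+1.
Proof. by rewrite /edge_point subrr scale0r scale1r add0r. Qed.

Lemma simple_polygon_inj (R : realType) (s : seq 'rV[R]_3) i j u v :
  simple_polygon s -> 0 <= u < 1 -> 0 <= v < 1 ->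
  edge_point s i u = edge_point s j v -> i = j %[mod size s] /\ u = v.
Proof.
move=> [sz inj] u01 v01; rewrite -edge_point_mod -(edge_point_mod s j).
by apply: inj => //; rewrite ltn_mod; lia.
Qed.

Lemma edge_point_half_open (R : realType) (s : seq 'rV[R]_3) i u :
  0 <= u <= 1 -> exists j v, [/\ 0 <= v < 1,
    edge_point s i u = edge_point s j v & j = i /\ v = u \/ j = i.+1 /\ v = 0].
Proof.
move=> /andP[u0]; rewrite le_eqVlt => /predU1P[->|u1].
  exists i.+1, 0; rewrite edge_point1 edge_point0 lexx ltr01; split=> //.
  by right.
by exists i, u; split=> //; [rewrite u0 | left].
Qed.

Lemma modn_succ_inj i j n : i.+1 = j.+1 %[mod n] -> i = j %[mod n].
Proof. by move/eqP; rewrite -(addn1 i) -(addn1 j) eqn_modDr => /eqP. Qed.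

Lemma simple_polygon_closed (R : realType) (s : seq 'rV[R]_3) i j u v :
  simple_polygon s -> 0 <= u <= 1 -> 0 <= v <= 1 ->
  edge_point s i u = edge_point s j v ->
  [\/ i = j %[mod size s], i.+1 = j %[mod size s] | i = j.+1 %[mod size s]].
Proof.
move=> ss u01 v01 E.
have [i' [u' [u'01 Ei ci]]] := edge_point_half_open s i u01.
have [j' [v' [v'01 Ej cj]]] := edge_point_half_open s j v01.
have [] := @simple_polygon_inj R s i' j' u' v' ss u'01 v'01.
  by rewrite -Ei -Ej.
case: ci cj => [][-> _] [][-> _].
- by constructor 1.
- by constructor 3.
- by constructor 2.
- by move=> /modn_succ_inj; constructor 1.
Qed.

Lemma simple_polygon_vertex_neq (R : realType) (s : seq 'rV[R]_3) i :
  simple_polygon s -> vertex s i <> vertex s i.+1.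
Proof.
move=> ss E; have [|||] := @simple_polygon_inj R s i i 0 2^-1 ss.
- by rewrite lexx ltr01.
- by apply/andP; split; lra.
- by rewrite edge_point0 /edge_point -E -scalerDl subrK scale1r.
by move=> _; lra.
Qed.

(** A vanishing combination of two consecutive edge vectors would make the
    polygon fold back onto itself at their common vertex. *)
Lemma simple_polygon_corner (R : realType) (s : seq 'rV[R]_3) i u :
  simple_polygon s -> 0 <= u <= 1 ->
  (1 - u) *: (vertex s i.+1 - vertex s i) +
    u *: (vertex s i.+2 - vertex s i.+1) <> 0.
Proof.
move=> ss /andP[u0 u1] E; have [uE|un1] := eqVneq u 1.
  move: E; rewrite uE subrr scale0r add0r scale1r => /eqP.
  by rewrite subr_eq0 => /eqP/esym; apply: simple_polygon_vertex_neq.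
have [|||] := @simple_polygon_inj R s i i.+1 (1 - (1 - u) / 2) (u / 2) ss.
- by apply/andP; split; lra.
- by apply/andP; split; lra.
- apply/subr0_eq; rewrite -[RHS](scaler0 _ (- 2^-1)) -E /edge_point; vec_ring.
rewrite -(addn1 i) -{1}[i]addn0 => /eqP; rewrite eqn_modDl mod0n => /eqP.
by rewrite modn_small //; case: ss => /ltnW.
Qed.

(** * Stability of simple polygons *)

Lemma edge_point_dist (R : realType) (s s' : seq 'rV[R]_3) (e u : R) i :
  (forall i, `|vertex s' i - vertex s i| <= e) -> 0 <= u <= 1 ->
  `|edge_point s' i u - edge_point s i u| <= e.
Proof.
move=> ss' /andP[u0 u1].
have -> : edge_point s' i u - edge_point s i u =
    (1 - u) *: (vertex s' i - vertex s i) +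
    u *: (vertex s' i.+1 - vertex s i.+1).
  by rewrite /edge_point; vec_ring.
rewrite (le_trans (ler_normD _ _)) // !normrZ !ger0_norm ?subr_ge0 //.
rewrite -[leRHS]mul1r -[X in X * e](subrK u) [leRHS]mulrDl lerD //.
  by rewrite ler_wpM2l // subr_ge0.
by rewrite ler_wpM2l.
Qed.

Section Expansion.
Context (R : realType) (s : seq 'rV[R]_3) (ss : simple_polygon s).

(* The displacement of the polygon, compared between a point of edge i and a
   point of edge j, is at most e / c times the distance of the two points as soon
   as every vertex moves by at most e. *)
Let expands (i j : nat) (c : R) := forall (s' : seq 'rV[R]_3) (e : R),
  (forall k, `|vertex s' k - vertex s k| <= e) ->
  forall u v, 0 <= u <= 1 -> 0 <= v <= 1 ->
    c * `|(edge_point s' i u - edge_point s i u) -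
          (edge_point s' j v - edge_point s j v)| <=
    e * `|edge_point s i u - edge_point s j v|.

Let expands_same i : exists2 c, 0 < c & expands i i c.
Proof.
have E0 : 0 < `|vertex s i.+1 - vertex s i|.
  rewrite normr_gt0 subr_eq0; apply/eqP => /esym.
  exact: simple_polygon_vertex_neq.
exists (`|vertex s i.+1 - vertex s i| / 2); first by rewrite divr_gt0.
move=> s' e ss' u v u01 v01.
have -> : (edge_point s' i u - edge_point s i u) -
          (edge_point s' i v - edge_point s i v) =
    (u - v) *: ((vertex s' i.+1 - vertex s i.+1) - (vertex s' i - vertex s i)).
  by rewrite /edge_point; vec_ring.
have -> : edge_point s i u - edge_point s i v =
    (u - v) *: (vertex s i.+1 - vertex s i).
  by rewrite /edge_point; vec_ring.
rewrite !normrZ mulrCA [leRHS]mulrCA ler_wpM2l //.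
set w := `|_ - _ - _|; have : w <= e * 2.
  by rewrite (le_trans (ler_normB _ _)) // mulr2n mulrDr mulr1 lerD.
by move=> /(ler_wpM2l (ltW E0)); lra.
Qed.

(* The displacements differ by at most 2 e times the sum of the parameters
   measured from the common vertex, and the distance of the points is at least a
   multiple of this sum, because the two edge vectors do not point in opposite
   directions. *)
Let expands_next i : exists2 c, 0 < c & expands i i.+1 c.
Proof.
pose a := vertex s i.+1 - vertex s i.
pose b := vertex s i.+2 - vertex s i.+1.
have [|c c0 cP] := @segments_distance R a b 0 0.
  move=> u v u01 _; rewrite !scaler0 addr0.
  exact: simple_polygon_corner.
have c20 : 0 <= c / 2 by rewrite divr_ge0 // ltW.
exists (c / 2); first by rewrite divr_gt0.
move=> s' e ss' u v /andP[u0 u1] /andP[v0 v1].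
have e0 : 0 <= e := le_trans (normr_ge0 _) (ss' 0).
pose w k := vertex s' k - vertex s k.
have -> : (edge_point s' i u - edge_point s i u) -
          (edge_point s' i.+1 v - edge_point s i.+1 v) =
    (1 - u) *: (w i - w i.+1) + v *: (w i.+1 - w i.+2).
  by rewrite /edge_point /w; vec_ring.
have dw k : `|w k - w k.+1| <= e * 2.
  rewrite (le_trans (ler_normB _ _)) // mulr2n mulrDr mulr1.
  by rewrite lerD //; apply: ss'.
have [h0|h0] := eqVneq (1 - u + v) 0.
  have [-> ->] : 1 - u = 0 /\ v = 0 by lra.
  by rewrite !scale0r addr0 normr0 mulr0 mulr_ge0.
have hp : 0 < 1 - u + v by rewrite lt_neqAle eq_sym h0 /=; lra.
pose t := v / (1 - u + v).
have t01 : 0 <= t <= 1.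
  by rewrite divr_ge0 ?(ltW hp) //= /t ler_pdivrMr // mul1r lerDr subr_ge0.
have := cP t 0 t01; rewrite lexx ler01 => /(_ isT).
rewrite !scaler0 addr0 subr0 => ct.
have -> : edge_point s i u - edge_point s i.+1 v =
    - ((1 - u + v) *: ((1 - t) *: a + t *: b)).
  have -> : (1 - u + v) *: ((1 - t) *: a + t *: b) =
      (1 - u) *: a + v *: b.
    rewrite scalerDr !scalerA mulrBr mulr1 [_ * t]mulrC /t divfK //.
    by congr (_ *: _ + _); ring.
  by rewrite /edge_point /a /b; vec_ring.
rewrite normrN normrZ (gtr0_norm hp).
apply: (@le_trans _ _ (c / 2 * ((1 - u + v) * (e * 2)))).
  rewrite ler_wpM2l ?c20 // (le_trans (ler_normD _ _)) //.
  rewrite !normrZ !ger0_norm ?subr_ge0 // [leRHS]mulrDl.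
  by rewrite lerD // ler_wpM2l // subr_ge0.
have -> : c / 2 * ((1 - u + v) * (e * 2)) = e * ((1 - u + v) * c) by field.
by rewrite ler_wpM2l // ler_wpM2l // ltW.
Qed.

Let expands_sym i j c : expands i j c -> expands j i c.
Proof.
move=> ij s' e ss' u v u01 v01.
by rewrite distrC [X in _ <= _ * X]distrC; apply: ij.
Qed.


(* Disjoint edges are at a positive distance, while any two displacements differ
   by at most 2 e. *)
Let expands_far i j : i <> j %[mod size s] -> i.+1 <> j %[mod size s] ->
  i <> j.+1 %[mod size s] -> exists2 c, 0 < c & expands i j c.
Proof.
move=> n1 n2 n3.
have [|c c0 cP] := @segments_distance R (vertex s i) (vertex s i.+1)
    (vertex s j) (vertex s j.+1).
  by move=> u v u01 v01 /(simple_polygon_closed ss u01 v01)[].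
have c20 : 0 <= c / 2 by rewrite divr_ge0 // ltW.
exists (c / 2); first by rewrite divr_gt0.
move=> s' e ss' u v u01 v01.
have e0 : 0 <= e := le_trans (normr_ge0 _) (ss' 0).
apply: (@le_trans _ _ (c / 2 * (e * 2))).
  rewrite ler_wpM2l ?c20 // (le_trans (ler_normB _ _)) //.
  by rewrite mulr2n mulrDr mulr1 lerD // edge_point_dist.
have -> : c / 2 * (e * 2) = e * c by field.
by rewrite ler_wpM2l // cP.
Qed.

Let expands_all i j : (i < size s)%N -> (j < size s)%N ->
  exists2 c, 0 < c & forall s' : seq 'rV[R]_3, size s' = size s ->
  forall e, (forall k, `|vertex s' k - vertex s k| <= e) ->
  forall u v, 0 <= u <= 1 -> 0 <= v <= 1 ->
    c * `|(edge_point s' i u - edge_point s i u) -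
          (edge_point s' j v - edge_point s j v)| <=
    e * `|edge_point s i u - edge_point s j v|.
Proof.
move=> ilt jlt.
have [E|n1] := pselect (i = j %[mod size s]).
  have {E}-> : i = j by rewrite !modn_small in E.
  by have [c c0 cP] := expands_same j; exists c => // s' _; apply: cP.
have [E|n2] := pselect (i.+1 = j %[mod size s]).
  have [c c0 cP] := expands_next i; exists c => // s' sz' e ss' u v u01 v01.
  rewrite -(edge_point_mod s j) -(edge_point_mod s' j) sz' -E.
  by rewrite -[X in edge_point s' (_ %% X)]sz' !edge_point_mod; apply: cP.
have [E|n3] := pselect (i = j.+1 %[mod size s]).
  have [c c0 /expands_sym cP] := expands_next j.
  exists c => // s' sz' e ss' u v u01 v01.
  rewrite -(edge_point_mod s i) -(edge_point_mod s' i) sz' E.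
  by rewrite -[X in edge_point s' (_ %% X)]sz' !edge_point_mod; apply: cP.
by have [c c0 cP] := expands_far n1 n2 n3; exists c => // s' _; apply: cP.
Qed.

(** A simple polygon is a bi-Lipschitz image of its parameter circle, so that
    moving its vertices by at most e displaces its points in a Lipschitz way, with
    constant O(e). *)
Lemma simple_polygon_expansion : exists2 c, 0 < c &
  forall s' : seq 'rV[R]_3, size s' = size s ->
  forall e, (forall k, `|vertex s' k - vertex s k| <= e) ->
  forall i j u v, (i < size s)%N -> (j < size s)%N ->
    0 <= u <= 1 -> 0 <= v <= 1 ->
    c * `|(edge_point s' i u - edge_point s i u) -
          (edge_point s' j v - edge_point s j v)| <=
    e * `|edge_point s i u - edge_point s j v|.
Proof.
pose P i j c := forall s' : seq 'rV[R]_3, size s' = size s ->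
  forall e, (forall k, `|vertex s' k - vertex s k| <= e) ->
  forall u v, 0 <= u <= 1 -> 0 <= v <= 1 ->
    c * `|(edge_point s' i u - edge_point s i u) -
          (edge_point s' j v - edge_point s j v)| <=
    e * `|edge_point s i u - edge_point s j v|.
have Pmono i j c c' : P i j c -> c' <= c -> P i j c'.
  move=> Pc c'c s' sz' e ss' u v u01 v01.
  by apply: le_trans (Pc s' sz' e ss' u v u01 v01); rewrite ler_wpM2r.
have [| |c c0 cP] := @finite_uniform R
    (fun i c => forall j, (j < size s)%N -> P i j c) (size s).
- by move=> i c c' Pc c'c j jlt; apply: Pmono c'c; apply: Pc.
- move=> i ilt; apply: finite_uniform => [j c c'|j jlt]; first exact: Pmono.
  exact: expands_all.
by exists c => // s' sz' e ss' i j u v ilt jlt; apply: cP.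
Qed.

End Expansion.

Lemma carrier_image (R : realType) (s : seq 'rV[R]_3) :
  carrier s = (fun x : nat * R => edge_point s x.1 x.2) @`
    [set x | (x.1 < size s)%N /\ 0 <= x.2 <= 1].
Proof.
apply/seteqP; split=> [p [i [u [ilt u01 ->]]]|_ [[i u] /= [ilt u01] <-]].
  by exists (i, u).
by exists i, u.
Qed.

(** Moving the vertices very little gives a simple polygon of the same knot type.
    A displacement of Lipschitz constant 1/3 has an inverse displacement of
    constant at most (1/3) / (1 - 1/3) = 1/2, so that the isotopy goes both
    ways. *)
Lemma simple_polygon_perturbation (R : realType) (s : seq 'rV[R]_3) :
  simple_polygon s -> exists2 e, 0 < e &
  forall s' : seq 'rV[R]_3, size s' = size s ->
  (forall i, `|vertex s' i - vertex s i| <= e) ->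
  [/\ simple_polygon s', ambient_isotopic (carrier s) (carrier s') &
      ambient_isotopic (carrier s') (carrier s)].
Proof.
move=> ss; have [c c0 cP] := simple_polygon_expansion ss.
exists (c / 3); first by rewrite divr_gt0.
move=> s' sz' ss'.
have {}cP i j u v : (i < size s)%N -> (j < size s)%N ->
    0 <= u <= 1 -> 0 <= v <= 1 ->
    `|(edge_point s' i u - edge_point s i u) -
      (edge_point s' j v - edge_point s j v)| <=
    3^-1 * `|edge_point s i u - edge_point s j v|.
  move=> ilt jlt u01 v01.
  by rewrite -(ler_pM2l c0) mulrA; apply: cP sz' _ ss' _ _ _ _ ilt jlt u01 v01.
split.
- split=> [|i j u v]; rewrite sz'; first by case: ss.
  move=> ilt jlt /andP[u0 u1] /andP[v0 v1] E.
  have [_] := ss; apply=> //; rewrite ?u0 ?v0 //; apply/eqP.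
  rewrite -subr_eq0 -normr_le0; have := cP i j u v ilt jlt.
  rewrite u0 v0 (ltW u1) (ltW v1) => /(_ isT isT).
  rewrite E; set x := edge_point s i u; set y := edge_point s j v.
  set y' := edge_point s' j v.
  have -> : y' - x - (y' - y) = - (x - y) by vec_ring.
  rewrite normrN.
  lra.
- rewrite !carrier_image sz'; apply: (@parametrized_isotopic _ _ _ _ _ 3^-1).
    by apply/andP; split; lra.
  by move=> [i u] [j v] /= [ilt u01] [jlt v01]; apply: cP.
- rewrite !carrier_image sz'; apply: (@parametrized_isotopic _ _ _ _ _ 2^-1).
    by apply/andP; split; lra.
  move=> [i u] [j v] /= [ilt u01] [jlt v01].
  have := cP i j u v ilt jlt u01 v01.
  set x := edge_point s i u; set y := edge_point s j v.
  set x' := edge_point s' i u; set y' := edge_point s' j v.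
  have -> : x - x' - (y - y') = - (x' - x - (y' - y)) by vec_ring.
  have : `|x - y| <= `|x' - y'| + `|x' - x - (y' - y)|.
    have -> : x - y = (x' - y') - (x' - x - (y' - y)) by vec_ring.
    exact: ler_normB.
  rewrite normrN; lra.
Qed.

(** * Polygons moving through simple polygons *)

Definition mix (R : realType) (t : R) (s0 s1 : seq 'rV[R]_3) :
    seq 'rV[R]_3 :=
  mkseq (fun i => (1 - t) *: s0`_i + t *: s1`_i) (size s0).

Lemma vertex_mix (R : realType) (t : R) (s0 s1 : seq 'rV[R]_3) i :
  (0 < size s0)%N -> size s1 = size s0 ->
  vertex (mix t s0 s1) i = (1 - t) *: vertex s0 i + t *: vertex s1 i.
Proof.
by move=> s0pos sz; rewrite /vertex size_mkseq nth_mkseq ?ltn_mod // sz.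
Qed.

(** The times at which the moving polygon is still isotopic to the initial one
    form a set that contains its supremum and a neighbourhood of it in [0, 1], by
    stability in both directions. *)
Lemma polygon_motion (R : realType) (s0 s1 : seq 'rV[R]_3) :
  size s1 = size s0 ->
  (forall t, 0 <= t <= 1 -> simple_polygon (mix t s0 s1)) ->
  ambient_isotopic (carrier s0) (carrier s1).
Proof.
move=> sz simple_mix.
have s0pos : (0 < size s0)%N.
  have [] := simple_mix 0; first by rewrite lexx ler01.
  by rewrite size_mkseq; lia.
have mix0 : mix 0 s0 s1 = s0.
  apply: (@eq_from_nth _ 0) => [|i]; rewrite size_mkseq // => ilt.
  by rewrite nth_mkseq // subr0 scale1r scale0r addr0.
have mix1 : mix 1 s0 s1 = s1.
  apply: (@eq_from_nth _ 0) => [|i]; rewrite size_mkseq // => ilt.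
  by rewrite nth_mkseq // subrr scale1r scale0r add0r.
pose W := 1 + \sum_(i < size s0) `|vertex s1 i - vertex s0 i|.
have W0 : 0 < W by rewrite ltr_pwDl // sumr_ge0.
have WP t t' i : `|vertex (mix t' s0 s1) i - vertex (mix t s0 s1) i| <=
    `|t' - t| * W.
  rewrite !vertex_mix //.
  have -> : (1 - t') *: vertex s0 i + t' *: vertex s1 i -
            ((1 - t) *: vertex s0 i + t *: vertex s1 i) =
      (t' - t) *: (vertex s1 i - vertex s0 i) by vec_ring.
  rewrite normrZ ler_wpM2l // -(vertex_mod s1) -(vertex_mod s0) sz.
  have ilt : (i %% size s0 < size s0)%N by rewrite ltn_mod.
  rewrite /W (bigD1 (Ordinal ilt)) //= addrCA lerDl addr_ge0 //.
  exact: sumr_ge0.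
have nearby t : 0 <= t <= 1 -> exists2 d, 0 < d &
    forall t', 0 <= t' <= 1 -> `|t' - t| <= d ->
    ambient_isotopic (carrier (mix t s0 s1)) (carrier (mix t' s0 s1)) /\
    ambient_isotopic (carrier (mix t' s0 s1)) (carrier (mix t s0 s1)).
  move=> t01; have [e e0 eP] := simple_polygon_perturbation (simple_mix t t01).
  exists (e / W); first by rewrite divr_gt0.
  move=> t' t'01 tt'; have [||] := eP (mix t' s0 s1); last by [].
    by rewrite !size_mkseq.
  by move=> i; rewrite (le_trans (WP _ _ _)) // -ler_pdivlMr.
pose S := [set t : R | 0 <= t <= 1 /\
  ambient_isotopic (carrier s0) (carrier (mix t s0 s1))].
have S0 : S 0.
  by split; [rewrite lexx ler01 | rewrite mix0; exact: ambient_isotopic_refl].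
have hS : has_sup S by split; [exists 0 | exists 1 => t [/andP[]]].
have T01 : 0 <= sup S <= 1.
  rewrite ub_le_sup //=; last by case: hS.
  by apply: ge_sup; [exists 0 | move=> t [/andP[]]].
have [d d0 dP] := nearby _ T01.
have ST : S (sup S).
  have [t St tT] := sup_adherent d0 hS.
  have tle : t <= sup S by apply: ub_le_sup => //; case: hS.
  have [t01 s0t] := St.
  split=> //; apply: ambient_isotopic_trans s0t _.
  by have [] := dP t t01; first by rewrite ler0_norm; lra.
suff -> : s1 = mix (sup S) s0 s1 by case: ST.
suff -> : sup S = 1 by [].
apply/eqP; rewrite eq_le; have /andP[T0 ->] /= := T01.
rewrite leNgt; apply/negP => T1.
pose t' := Num.min 1 (sup S + d).
have t'T : sup S < t' by rewrite lt_min T1 ltrDl.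
have t'd : t' <= sup S + d by rewrite ge_min lexx orbT.
have t'01 : 0 <= t' <= 1 by rewrite (le_trans T0 (ltW t'T)) ge_min lexx.
have St' : S t'.
  split=> //; apply: ambient_isotopic_trans (ST.2) _.
  by have [] := dP t' t'01; first by rewrite ger0_norm; lra.
have : t' <= sup S by apply: ub_le_sup => //; case: hS.
by rewrite leNgt t'T.
Qed.

Lemma edge_point_map (R : realType) (f : 'rV[R]_3 -> 'rV[R]_3)
    (s : seq 'rV[R]_3) i u :
  (forall a x y, f (a *: x + y) = a *: f x + f y) -> (0 < size s)%N ->
  edge_point (map f s) i u = f (edge_point s i u).
Proof.
move=> lin spos; have f0 : f 0 = 0.
  by have := lin (-1) 0 0; rewrite scaler0 addr0 scaleN1r addNr => ->.
have fZ a x : f (a *: x) = a *: f x by rewrite -[a *: x]addr0 lin f0 addr0.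
have fv k : vertex (map f s) k = f (vertex s k).
  by rewrite /vertex size_map (nth_map 0) // ltn_mod.
by rewrite /edge_point !fv lin fZ.
Qed.

Lemma simple_polygon_map (R : realType) (f : 'rV[R]_3 -> 'rV[R]_3)
    (s : seq 'rV[R]_3) :
  (forall a x y, f (a *: x + y) = a *: f x + f y) ->
  (forall x, f x = 0 -> x = 0) ->
  simple_polygon s -> simple_polygon (map f s).
Proof.
move=> lin inj [sz ss]; have spos : (0 < size s)%N by lia.
split; rewrite size_map // => i j u v ilt jlt u01 v01.
rewrite !edge_point_map // => E; apply: ss => //; apply/subr0_eq/inj.
by rewrite -scaleN1r addrC lin E scaleN1r addNr.
Qed.

(** If no map (1 - t) id + t f has a kernel, the polygon stays simple while it
    moves along straight lines to its image. *)
Lemma linear_motion (R : realType) (f : 'rV[R]_3 -> 'rV[R]_3)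
    (s : seq 'rV[R]_3) :
  (forall a x y, f (a *: x + y) = a *: f x + f y) ->
  (forall t x, 0 <= t <= 1 -> (1 - t) *: x + t *: f x = 0 -> x = 0) ->
  simple_polygon s ->
  simple_polygon (map f s) /\ ambient_isotopic (carrier s) (carrier (map f s)).
Proof.
move=> lin inj ss; split.
  apply: simple_polygon_map => // x fx0; apply: (inj 1).
    by rewrite ler01 lexx.
  by rewrite subrr scale0r scale1r add0r.
apply: polygon_motion => [|t t01]; first by rewrite size_map.
have -> : mix t s (map f s) = map (fun x => (1 - t) *: x + t *: f x) s.
  apply: (@eq_from_nth _ 0) => [|i]; rewrite size_mkseq ?size_map // => ilt.
  by rewrite nth_mkseq // !(nth_map 0).
apply: simple_polygon_map => // [a x y|x]; last exact: inj.
rewrite lin; vec_ring.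
Qed.

Lemma nth_rot_mod (T : Type) (x0 : T) (s : seq T) k i :
  (k <= size s)%N -> (0 < size s)%N ->
  nth x0 (rot k s) (i %% size s) = nth x0 s ((i + k) %% size s).
Proof.
move=> ks spos; rewrite /rot nth_cat size_drop -(modnDml i).
move: (i %% size s)%N (ltn_pmod i spos) => m mlt; case: ltnP => h.
  by rewrite nth_drop (addnC k) modn_small //; lia.
have -> : (m + k = (m - (size s - k)) + size s)%N by lia.
by rewrite modnDr modn_small ?nth_take //; lia.
Qed.

(** * Inserting and removing a vertex *)

Definition segment (R : realType) (a b : 'rV[R]_3) : set 'rV[R]_3 :=
  [set p | exists2 u, 0 <= u <= 1 & p = (1 - u) *: a + u *: b].

Definition triangle (R : realType) (a b c : 'rV[R]_3) : set 'rV[R]_3 :=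
  [set p | exists x y, [/\ 0 <= x, 0 <= y, x + y <= 1 &
    p = a + x *: (b - a) + y *: (c - a)]].

Definition independent (R : realType) (x y : 'rV[R]_3) : Prop :=
  forall a b, a *: x + b *: y = 0 -> a = 0 /\ b = 0.

Lemma independent_inj (R : realType) (x y : 'rV[R]_3) (a b a' b' : R) :
  independent x y -> a *: x + b *: y = a' *: x + b' *: y -> a = a' /\ b = b'.
Proof.
move=> xy E; have [] := xy (a - a') (b - b').
  by apply/eqP; rewrite !scalerBl addrACA -opprD E subrr.
by move=> /subr0_eq -> /subr0_eq ->.
Qed.

Definition tail_carrier (R : realType) (s : seq 'rV[R]_3) : set 'rV[R]_3 :=
  [set p | exists i u,
    [/\ (0 < i < size s)%N, 0 <= u <= 1 & p = edge_point s i u]].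

Section Insertion.
Context (R : realType).
Implicit Types (A B C p : 'rV[R]_3) (r s : seq 'rV[R]_3).

Lemma vertex_rot s k i : (k <= size s)%N ->
  vertex (rot k s) i = vertex s (i + k).
Proof.
move=> ks; rewrite /vertex size_rot; have [s0|spos] := posnP (size s).
  by rewrite (size0nil s0) /= !nth_nil.
exact: nth_rot_mod.
Qed.

Lemma edge_point_rot s k i u : (k <= size s)%N ->
  edge_point (rot k s) i u = edge_point s (i + k) u.
Proof. by move=> ks; rewrite /edge_point !vertex_rot. Qed.

Lemma carrier_rot s k : (k <= size s)%N -> carrier (rot k s) = carrier s.
Proof.
move=> ks; apply/seteqP; split=> p [i [u []]]; rewrite ?size_rot => ilt u01 ->.
  rewrite edge_point_rot // -edge_point_mod; exists ((i + k) %% size s)%N, u.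
  by split=> //; rewrite ltn_mod; lia.
exists ((i + (size s - k)) %% size s)%N, u; split=> //.
  by rewrite size_rot ltn_mod; lia.
rewrite -[X in (_ %% X)%N](size_rot k) edge_point_mod edge_point_rot //.
by rewrite -addnA subnK // -[RHS]edge_point_mod modnDr edge_point_mod.
Qed.

Lemma simple_polygon_rot s k : (k <= size s)%N ->
  simple_polygon s -> simple_polygon (rot k s).
Proof.
move=> ks ss; split; first by rewrite size_rot; case: ss.
rewrite size_rot => i j u v ilt jlt u01 v01; rewrite !edge_point_rot // => E.
have [/eqP] := simple_polygon_inj ss u01 v01 E.
by rewrite eqn_modDr !modn_small // => /eqP.
Qed.

Lemma carrier_head A B r :
  carrier (A :: B :: r) = segment A B `|` tail_carrier (A :: B :: r).
Proof.
apply/seteqP; split=> p.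
  move=> [[|i] [u [ilt u01 ->]]]; [by left; exists u | by right; exists i.+1, u].
move=> [[u u01 ->]|[i [u [il u01 ->]]]].
- by exists 0, u.
- by exists i, u; split=> //; case/andP: il.
Qed.

Lemma edge_point_head A B r u :
  edge_point (A :: B :: r) 0 u = (1 - u) *: A + u *: B.
Proof. by rewrite /edge_point /vertex !modn_small. Qed.

Lemma edge_point_second A C B r u :
  edge_point (A :: C :: B :: r) 1 u = (1 - u) *: C + u *: B.
Proof. by rewrite /edge_point /vertex !modn_small. Qed.

Lemma edge_point_insert A C B r i u : (0 < i < (size r).+2)%N ->
  edge_point (A :: C :: B :: r) i.+1 u = edge_point (A :: B :: r) i u.
Proof.
case: i => // i /= ilt.
have E k : (k < (size r).+2)%N ->
    vertex (A :: C :: B :: r) k.+2 = vertex (A :: B :: r) k.+1.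
  rewrite /vertex /= ltnS leq_eqVlt => /predU1P[->|klt].
    by rewrite !modnn.
  by rewrite !modn_small.
by rewrite /edge_point !E //; lia.
Qed.

Lemma tail_carrier_insert A C B r :
  tail_carrier (A :: C :: B :: r) =
  segment C B `|` tail_carrier (A :: B :: r).
Proof.
apply/seteqP; split=> p; last first.
  move=> [[u u01 ->]|[i [u [il u01 ->]]]].
    by exists 1%N, u; split=> //; rewrite edge_point_second.
  exists i.+1, u; split=> //; last by rewrite edge_point_insert.
  by case/andP: il.
move=> [[|[|i]] [u [//= il u01 ->]]].
  by left; exists u => //; rewrite edge_point_second.
by right; exists i.+1, u; split=> //; rewrite edge_point_insert.
Qed.

(** Among the edges of A :: C :: B :: r, only the first two are not edges of
    A :: B :: r. *)
Lemma simple_polygon_insert A C B r : r <> [::] ->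
  (forall i j u v, (0 < i < (size r).+2)%N -> (0 < j < (size r).+2)%N ->
    0 <= u < 1 -> 0 <= v < 1 ->
    edge_point (A :: B :: r) i u = edge_point (A :: B :: r) j v ->
    i = j /\ u = v) ->
  A <> C -> C <> B ->
  (forall u v, 0 <= u < 1 -> 0 <= v < 1 ->
    (1 - u) *: A + u *: C <> (1 - v) *: C + v *: B) ->
  (forall i u v, (0 < i < (size r).+2)%N -> 0 <= u < 1 -> 0 <= v < 1 ->
    edge_point (A :: B :: r) i u <> (1 - v) *: A + v *: C /\
    edge_point (A :: B :: r) i u <> (1 - v) *: C + v *: B) ->
  simple_polygon (A :: C :: B :: r).
Proof.
move=> rn tail AC CB new newtail; split; first by case: r rn {tail newtail}.
have lin (x y : 'rV[R]_3) u v : x <> y ->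
    (1 - u) *: x + u *: y = (1 - v) *: x + v *: y -> u = v.
  move=> xy E; apply/eqP; rewrite -subr_eq0; apply/negPn/negP => uv; apply: xy.
  apply: (scalerI uv); apply/subr0_eq.
  have -> : (u - v) *: x - (u - v) *: y =
    - ((1 - u) *: x + u *: y - ((1 - v) *: x + v *: y)) by vec_ring.
  by rewrite E subrr oppr0.
move=> i j u v /= ilt jlt u01 v01.
case: i ilt => [_|[_|i ilt]]; case: j jlt => [_|[_|j jlt]].
- by rewrite !edge_point_head => /(lin _ _ _ _ AC).
- by rewrite edge_point_head edge_point_second => /new; case.
- rewrite edge_point_head edge_point_insert // => /esym.
  by have [|||H _ /H] := newtail j.+1 v u.
- by rewrite edge_point_head edge_point_second => /esym/new; case.
- by rewrite !edge_point_second => /(lin _ _ _ _ CB).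
- rewrite edge_point_second edge_point_insert // => /esym.
  by have [|||_ H /H] := newtail j.+1 v u.
- rewrite edge_point_head edge_point_insert //.
  by have [|||H _ /H] := newtail i.+1 u v.
- rewrite edge_point_second edge_point_insert //.
  by have [|||_ H /H] := newtail i.+1 u v.
- by rewrite !edge_point_insert // => /tail[//|//|//|//|[->] ->].
Qed.

Lemma simple_polygon_tail A B r i j u v : simple_polygon (A :: B :: r) ->
  (0 < i < (size r).+2)%N -> (0 < j < (size r).+2)%N ->
  0 <= u < 1 -> 0 <= v < 1 ->
  edge_point (A :: B :: r) i u = edge_point (A :: B :: r) j v ->
  i = j /\ u = v.
Proof. by move=> [_ ss] /andP[_ ilt] /andP[_ jlt]; apply: ss. Qed.

Lemma simple_polygon_size A B r : simple_polygon (A :: B :: r) -> r <> [::].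
Proof. by case: r => // -[]. Qed.

Lemma simple_polygon_subdivide A B r (l : R) :
  0 < l < 1 -> simple_polygon (A :: B :: r) ->
  simple_polygon (A :: ((1 - l) *: A + l *: B) :: B :: r) /\
  carrier (A :: ((1 - l) *: A + l *: B) :: B :: r) = carrier (A :: B :: r).
Proof.
move=> /andP[l0 l1] ss; set M := _ + _.
have E1 u : (1 - u) *: A + u *: M = edge_point (A :: B :: r) 0 (u * l).
  by rewrite edge_point_head /M; vec_ring.
have E2 u : (1 - u) *: M + u *: B =
    edge_point (A :: B :: r) 0 ((1 - u) * l + u).
  by rewrite edge_point_head /M; vec_ring.
have h1 u : 0 <= u < 1 -> 0 <= u * l < 1 by move=> /andP[u0 u1]; nra.
have h2 u : 0 <= u < 1 -> 0 <= (1 - u) * l + u < 1.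
  by move=> /andP[u0 u1]; apply/andP; split; nra.
have [_ inj] := ss.
have AB : A <> B := @simple_polygon_vertex_neq R _ 0 ss.
split.
  apply: simple_polygon_insert.
  - exact: simple_polygon_size ss.
  - by move=> i j u v; apply: simple_polygon_tail.
  - move=> E; apply: AB; apply: (scalerI (lt0r_neq0 l0)); apply/subr0_eq.
    have -> : l *: A - l *: B = A - M by rewrite /M; vec_ring.
    by rewrite -E subrr.
  - move=> E; apply: AB; have l1' : 1 - l != 0 by rewrite subr_eq0 gt_eqF.
    apply: (scalerI l1'); apply/subr0_eq.
    have -> : (1 - l) *: A - (1 - l) *: B = M - B by rewrite /M; vec_ring.
    by rewrite E subrr.
  - move=> u v u01 v01; rewrite E1 E2 => /(inj 0 0 _ _)[|||| _] //.
    + exact: h1.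
    + exact: h2.
    + by move: u01 v01 => /andP[u0 u1] /andP[v0 v1]; nra.
  - move=> i u v il u01 v01; rewrite E1 E2; split=> /inj[]//.
    + by case/andP: il.
    + exact: h1.
    + by move=> i0; rewrite i0 in il.
    + by case/andP: il.
    + exact: h2.
    + by move=> i0; rewrite i0 in il.
rewrite !carrier_head tail_carrier_insert setUA; congr (_ `|` _).
apply/seteqP; split=> [p [] [u /andP[u0 u1]]|p [u /andP[u0 u1] ->]].
- rewrite E1 edge_point_head => ->; exists (u * l) => //.
  by apply/andP; split; nra.
- rewrite E2 edge_point_head => ->; exists ((1 - u) * l + u) => //.
  by apply/andP; split; nra.
have [ul|lu] := leP u l; [left|right].
  exists (u / l); last by rewrite E1 edge_point_head divfK ?gt_eqF.
  by rewrite divr_ge0 ?(ltW l0) //= ler_pdivrMr // mul1r.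
have l1' : 0 < 1 - l by rewrite subr_gt0.
exists ((u - l) / (1 - l)).
  rewrite divr_ge0 ?subr_ge0 ?(ltW lu) ?(ltW l1) //=.
  by rewrite ler_pdivrMr // mul1r lerD2r.
rewrite E2 edge_point_head; suff <- : u = (1 - (u - l) / (1 - l)) * l +
  (u - l) / (1 - l) by [].
by field; rewrite gt_eqF.
Qed.

(** An edge AB can be replaced by AC, CB when the triangle is otherwise free of
    the polygon. A vertex is first inserted at the midpoint of AB, which leaves
    the carrier unchanged; it then moves straight to C, inside the triangle, and
    the polygon stays simple. *)
Lemma triangle_insert A B C r :
  simple_polygon (A :: B :: r) -> independent (C - A) (B - A) ->
  triangle A C B `&` carrier (A :: B :: r) `<=` segment A B ->
  [/\ simple_polygon (A :: C :: B :: r),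
      ambient_isotopic (carrier (A :: B :: r)) (carrier (A :: C :: B :: r)) &
      ambient_isotopic (carrier (A :: C :: B :: r)) (carrier (A :: B :: r))].
Proof.
move=> ss ind disj; pose M := (1 - 2^-1) *: A + 2^-1 *: B.
(* The moving vertex, and points of the plane ABC in the coordinates with origin
   A and axes AC and AB. *)
pose Ct (t : R) := (1 - t) *: M + t *: C.
pose pt (a b : R) := A + a *: (C - A) + b *: (B - A).
have pt_inj a b a' b' : pt a b = pt a' b' -> a = a' /\ b = b'.
  rewrite /pt -!addrA => /addrI; exact: independent_inj.
have AE : A = pt 0 0 by rewrite /pt; vec_ring.
have BE : B = pt 0 1 by rewrite /pt; vec_ring.
have ABE z : (1 - z) *: A + z *: B = pt 0 z by rewrite /pt; vec_ring.
have CtE t : Ct t = pt t ((1 - t) / 2).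
  by rewrite /pt /Ct /M; apply/rowP => i; rewrite !mxE; field.
have ACE t u : (1 - u) *: A + u *: Ct t = pt (u * t) (u * ((1 - t) / 2)).
  by rewrite CtE /pt; vec_ring.
have CBE t u : (1 - u) *: Ct t + u *: B =
    pt ((1 - u) * t) ((1 - u) * ((1 - t) / 2) + u).
  by rewrite CtE /pt; vec_ring.
have meet a b i u : (0 < i < (size r).+2)%N -> 0 <= u < 1 ->
    0 <= a -> 0 <= b -> a + b <= 1 ->
    edge_point (A :: B :: r) i u = pt a b -> a = 0 /\ b = 1.
  move=> /andP[i0 ilt] u01 a0 b0 ab1 E.
  have [|z /andP[z0 z1] Ez] := disj (pt a b).
    split; first by exists a, b.
    exists i, u; split=> //; by case/andP: u01 => -> /ltW.
  have [az bz] : a = 0 /\ b = z by apply: pt_inj; rewrite Ez ABE.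
  split=> //; rewrite bz; apply/eqP; rewrite eq_le z1 leNgt; apply/negP => zlt.
  have z01 : 0 <= z < 1 by rewrite z0.
  have E' : edge_point (A :: B :: r) i u = edge_point (A :: B :: r) 0 z.
    by rewrite edge_point_head ABE -bz -az.
  have [i0' _] := ss.2 i 0%N u z ilt isT u01 z01 E'.
  by rewrite i0' in i0.
have sCt t : 0 <= t <= 1 -> simple_polygon (A :: Ct t :: B :: r).
  move=> /andP[t0 t1]; apply: simple_polygon_insert.
  - exact: simple_polygon_size ss.
  - by move=> i j u v; apply: simple_polygon_tail.
  - by rewrite {1}AE CtE => /pt_inj[]; lra.
  - by rewrite {1}BE CtE => /pt_inj[]; lra.
  - move=> u v /andP[u0 u1] /andP[v0 v1]; rewrite ACE CBE => /pt_inj[]; nra.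
  - move=> i u v il u01 /andP[v0 v1]; rewrite ACE CBE.
    by split=> /(meet _ _ _ _ il u01)[]; nra.
have mixE t : mix t (A :: M :: B :: r) (A :: C :: B :: r) = A :: Ct t :: B :: r.
  have E (x : 'rV[R]_3) : (1 - t) *: x + t *: x = x by vec_ring.
  apply: (@eq_from_nth _ 0) => [|i]; rewrite size_mkseq // => ilt.
  by rewrite nth_mkseq //; case: i ilt => [|[|[|i]]] _ /=; rewrite ?E.
have mixE' t : mix t (A :: C :: B :: r) (A :: M :: B :: r) =
    A :: Ct (1 - t) :: B :: r.
  have E (x : 'rV[R]_3) : (1 - t) *: x + t *: x = x by vec_ring.
  apply: (@eq_from_nth _ 0) => [|i]; rewrite size_mkseq // => ilt.
  rewrite nth_mkseq //; case: i ilt => [|[|[|i]]] _ /=; rewrite ?E //.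
  by rewrite /Ct subKr addrC.
have [|_ carM] := @simple_polygon_subdivide A B r 2^-1 _ ss.
  by apply/andP; split; lra.
rewrite -carM -/M; split.
- have -> : C = Ct 1 by rewrite /Ct subrr scale0r add0r scale1r.
  by apply: sCt; rewrite ler01 lexx.
- by apply: polygon_motion => // t t01; rewrite mixE; apply: sCt.
- apply: polygon_motion => // t /andP[t0 t1]; rewrite mixE'; apply: sCt.
  by rewrite subr_ge0 t1 lerBlDr lerDl.
Qed.

(** The converse move. The shortened polygon is simple because its new edge lies
    in the triangle, and it satisfies the hypotheses of the insertion move, which
    gives the isotopy. *)
Lemma triangle_remove A B C r : r <> [::] ->
  simple_polygon (A :: C :: B :: r) -> independent (C - A) (B - A) ->
  triangle A C B `&` carrier (A :: C :: B :: r) `<=`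
    segment A C `|` segment C B ->
  simple_polygon (A :: B :: r) /\
  ambient_isotopic (carrier (A :: C :: B :: r)) (carrier (A :: B :: r)).
Proof.
move=> rn ss ind disj.
pose pt (a b : R) := A + a *: (C - A) + b *: (B - A).
have pt_inj a b a' b' : pt a b = pt a' b' -> a = a' /\ b = b'.
  rewrite /pt -!addrA => /addrI; exact: independent_inj.
have AE : A = pt 0 0 by rewrite /pt; vec_ring.
have BE : B = pt 0 1 by rewrite /pt; vec_ring.
have ABE z : (1 - z) *: A + z *: B = pt 0 z by rewrite /pt; vec_ring.
have ACE u : (1 - u) *: A + u *: C = pt u 0 by rewrite /pt; vec_ring.
have CBE u : (1 - u) *: C + u *: B = pt (1 - u) u by rewrite /pt; vec_ring.
have spos : (0 < size r)%N by case: r rn {ss disj}.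
have sAB : simple_polygon (A :: B :: r).
  have head i u v : (0 < i < (size r).+2)%N -> 0 <= u < 1 -> 0 <= v < 1 ->
      edge_point (A :: B :: r) i u <> edge_point (A :: B :: r) 0 v.
    move=> il u01 /andP[v0 v1] E.
    have Ev : edge_point (A :: C :: B :: r) i.+1 u = pt 0 v.
      by rewrite edge_point_insert // E edge_point_head ABE.
    have [|[z z01]|[z z01]] := disj (pt 0 v).
    - split; first by exists 0, v; split; rewrite ?add0r // ltW.
      exists i.+1, u; split=> //; first by case/andP: il.
      by case/andP: u01 => -> /ltW.
    - rewrite ACE => /pt_inj[_ v00].
      have [] := ss.2 i.+1 0%N u 0 => //; first by case/andP: il.
        by rewrite lexx ltr01.
      by rewrite Ev edge_point0 v00 -AE.
    - rewrite CBE => /pt_inj[]; lra.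
  split; first by rewrite /= ltnS.
  move=> [|i] [|j] u v ilt jlt u01 v01.
  - rewrite !edge_point_head !ABE => /pt_inj[_ ->]; by [].
  - by move=> /esym E; case: (head j.+1 v u _ v01 u01 E).
  - by move=> E; case: (head i.+1 u v _ u01 v01 E).
  - rewrite -(@edge_point_insert A C B r i.+1) //.
    rewrite -(@edge_point_insert A C B r j.+1) //.
    by move=> E; have [||[->] ->] := ss.2 i.+2 j.+2 u v _ _ u01 v01 E.
split=> //.
have [|_ _] // := triangle_insert sAB ind.
move=> p [tp]; rewrite carrier_head => -[//|cp].
have [|[z z01]|[z z01]] := disj p.
- by split=> //; rewrite carrier_head tail_carrier_insert; right; right.
- rewrite -(edge_point_head A C (B :: r)) => Ez.
  have [i [u [/andP[i0 ilt] u01 Ep]]] := cp.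
  rewrite -(@edge_point_insert A C B r i) in Ep; last by rewrite i0.
  have [j [v [v01 Ej cj]]] := edge_point_half_open (A :: C :: B :: r) i.+1 u01.
  have [k [w [w01 Ek ck]]] := edge_point_half_open (A :: C :: B :: r) 0 z01.
  have [] := simple_polygon_inj ss v01 w01 (etrans (esym Ej)
    (etrans (etrans (esym Ep) Ez) Ek)).
  rewrite /= in ilt *.
  case: cj => -[-> ->]; case: ck => -[-> ->].
  + by rewrite mod0n modn_small.
  + by move=> /eqP; rewrite !modn_small // eqSS => /eqP i0'; rewrite i0' in i0.
  + move=> _ z0; exists 0; first by rewrite lexx ler01.
    by rewrite Ez -z0 edge_point_head !subr0 !scale1r !scale0r.
  + move=> /modn_succ_inj; rewrite mod0n modn_small //.
- rewrite -(edge_point_second A C B r) => Ez.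
  have [z1|z1] := eqVneq z 1.
    exists 1; first by rewrite ler01 lexx.
    by rewrite Ez z1 edge_point_second !subrr !scale0r.
  have [i [u [/andP[i0 ilt] u01 Ep]]] := cp.
  rewrite -(@edge_point_insert A C B r i) in Ep; last by rewrite i0.
  have [j [v [v01 Ej cj]]] := edge_point_half_open (A :: C :: B :: r) i.+1 u01.
  have zlt : 0 <= z < 1 by case/andP: z01 => -> z1'; rewrite lt_neqAle z1.
  have [] := simple_polygon_inj ss v01 zlt (etrans (esym Ej)
    (etrans (esym Ep) Ez)).
  rewrite /= in ilt *.
  case: cj => -[-> ->].
  + move=> E _; have := @modn_succ_inj i 0 _ E.
    by rewrite mod0n modn_small => [i0'|]; [rewrite i0' in i0 | exact: ltnW].
  + by move=> E _; have := @modn_succ_inj i.+1 0 _ E; rewrite mod0n modn_small.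
Qed.

End Insertion.

(** * Refining the edges of a polygon *)

Section Refinement.
Context (R : realType).
Implicit Types (A B C p : 'rV[R]_3) (r s z : seq 'rV[R]_3).

(** The rest r of the polygon is universally quantified, as the other edges may
    already have been refined. *)
Definition refines_edge (e : rel 'rV[R]_3) A B : Prop :=
  forall r, simple_polygon (A :: B :: r) -> exists z,
    [/\ path e A (rcons z B), simple_polygon (A :: z ++ B :: r) &
        ambient_isotopic (carrier (A :: B :: r)) (carrier (A :: z ++ B :: r))].

(** The edges are processed in turn. In the cyclic walk from A back to A, the
    part t1 still consists of edges to process and the part t2 of processed
    edges; rotating the polygon appends each newly processed edge to t2. *)
Lemma refine_polygon (q e : rel 'rV[R]_3) s :
  (forall A B, q A B -> refines_edge e A B) ->
  simple_polygon s -> cycle q s ->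
  exists s', [/\ simple_polygon s', ambient_isotopic (carrier s) (carrier s') &
    cycle e s'].
Proof.
move=> qe; case: s => [[]//|A s] ss qs.
suff: forall t1 t2 A s, simple_polygon (A :: s) -> rcons s A = t1 ++ t2 ->
    path q A t1 -> path e (last A t1) t2 -> exists s',
    [/\ simple_polygon s', ambient_isotopic (carrier (A :: s)) (carrier s') &
      cycle e s'].
  by move=> /(_ (rcons s A) [::] A s ss); rewrite cats0; apply.
move=> {A s ss qs}; elim=> [|B t1 IH] t2 A s ss E /=.
  move=> _ et2; exists (A :: s); split=> //; first exact: ambient_isotopic_refl.
  by rewrite /= E.
move=> /andP[qAB qt1] et2.
case: s ss E => [[]//|B' r] ss [EB E]; subst B'.
have [z [ez sz iz]] := qe A B qAB r ss.
have rotE : rot (size (A :: z)) (A :: z ++ B :: r) = B :: r ++ A :: z.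
  by rewrite -cat_cons rot_size_cat.
have szle : (size (A :: z) <= size (A :: z ++ B :: r))%N.
  by rewrite -cat_cons size_cat leq_addr.
have := simple_polygon_rot szle sz; rewrite rotE => srot.
have [|//||s' [ss' is' es']] := IH (t2 ++ rcons z B) B (r ++ A :: z) srot.
- by rewrite rcons_cat /= -cat_rcons E catA.
- rewrite cat_path et2 /= -last_cat; suff -> : last B (t1 ++ t2) = A by [].
  by rewrite -E last_rcons.
exists s'; split=> //; apply: ambient_isotopic_trans iz _.
by rewrite -(carrier_rot szle) rotE.
Qed.

(** The half, on one side of the diagonal, of the l-th square along the diagonal
    of the plane through A with axes f and g. It is the triangle between the
    straight path from A + l (f + g) to A + (l + 1) (f + g) and one of the two
    paths by f and g; b tells which one. *)
Definition tooth (f g A : 'rV[R]_3) (l : nat) (b : bool) : set 'rV[R]_3 :=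
  [set p | exists x y, [/\ l%:R <= x <= l.+1%:R, l%:R <= y <= l.+1%:R,
    (if b then y <= x else x <= y) & p = A + x *: f + y *: g]].

Lemma tooth_triangle (f g A : 'rV[R]_3) (b : bool) :
  triangle A (A + if b then f else g) (A + f + g) `<=` tooth f g A 0 b.
Proof.
move=> _ [x [y [x0 y0 xy ->]]]; case: b.
  exists (x + y), y; rewrite mulr0n mulr1n; split;
    by [apply/andP; split; lra | vec_ring | lra].
exists y, (x + y); rewrite mulr0n mulr1n; split;
  by [apply/andP; split; lra | vec_ring | lra].
Qed.

Lemma independent_tooth (f g : 'rV[R]_3) (b : bool) : independent f g ->
  independent (if b then f else g) (f + g).
Proof.
move=> fg x y E; case: b E => E.
  have [|xy y0] := fg (x + y) y; last by split=> //; lra.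
  by rewrite -E; vec_ring.
have [|y0 xy] := fg y (x + y); last by split=> //; lra.
by rewrite -E; vec_ring.
Qed.

(** The teeth are added one at a time. A new tooth meets the previous one in a
    vertex at most, since both coordinates of its points lie in [l, l + 1], so it
    is enough that all teeth be free of the initial polygon. *)
Lemma zigzag_teeth (f g : 'rV[R]_3) n A B r (side : nat -> bool) :
  independent f g -> B = A + n.+1%:R *: (f + g) ->
  simple_polygon (A :: B :: r) ->
  (forall l, (l <= n)%N ->
    tooth f g A l (side l) `&` carrier (A :: B :: r) `<=` segment A B) ->
  exists z, [/\ path (fun a b => (b - a == f) || (b - a == g)) A (rcons z B),
    simple_polygon (A :: z ++ B :: r) &
    ambient_isotopic (carrier (A :: B :: r)) (carrier (A :: z ++ B :: r))].
Proof.
move=> fg; elim: n => [|n IH] in A B r side *.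
  rewrite scale1r => BE ss /(_ 0%N isT) disj.
  pose C := A + if side 0%N then f else g.
  have CA : C - A = if side 0%N then f else g by rewrite /C addrC addKr.
  have BA : B - A = f + g by rewrite BE addrC addKr.
  have [||sC iC _] := @triangle_insert R A B C r ss.
  - by rewrite CA BA; exact: independent_tooth.
  - move=> p [tp cp]; apply: disj; split=> //; apply: tooth_triangle.
    by rewrite -addrA -BE.
  exists [:: C]; split=> //=; rewrite CA andbT.
  have -> : B - C = if side 0%N then g else f.
    by rewrite BE /C; case: (side 0%N); vec_ring.
  by case: (side 0%N); rewrite !eqxx ?orbT.
move=> BE ss disj.
pose C := A + if side 0%N then f else g.
pose A1 := A + (f + g).
have CA : C - A = if side 0%N then f else g by rewrite /C addrC addKr.
have A1A : A1 - A = f + g by rewrite /A1 addrC addKr.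
have A1C : A1 - C = if side 0%N then g else f.
  by rewrite /A1 /C; case: (side 0%N); vec_ring.
have n2 : 0 < n.+2%:R :> R by rewrite ltr0n.
have A1E : A1 = (1 - n.+2%:R^-1) *: A + n.+2%:R^-1 *: B.
  rewrite BE /A1; move: (n.+2%:R : R) (lt0r_neq0 n2) => a a0.
  by apply/rowP => i; rewrite !mxE; field.
have l01 : 0 < (n.+2%:R^-1 : R) < 1.
  by rewrite invr_gt0 n2 invf_lt1 // ltr1n.
have [ss1 car1] := simple_polygon_subdivide l01 ss.
rewrite -A1E in ss1 car1.
pose pt (x y : R) := A + x *: f + y *: g.
have pt_inj x y x' y' : pt x y = pt x' y' -> x = x' /\ y = y'.
  rewrite /pt -!addrA => /addrI; exact: independent_inj.
have seg_pt a b p : a < b -> segment (pt a a) (pt b b) p <->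
    exists2 x, a <= x <= b & p = pt x x.
  move=> ab; split=> [[u /andP[u0 u1] ->]|[x /andP[ax xb] ->]].
    exists ((1 - u) * a + u * b); last by rewrite /pt; vec_ring.
    by apply/andP; split; nra.
  have ab0 : 0 < b - a by rewrite subr_gt0.
  exists ((x - a) / (b - a)).
    by rewrite divr_ge0 ?subr_ge0 ?(ltW ab) //= ler_pdivrMr // mul1r lerD2r.
  rewrite /pt; apply/rowP => i; rewrite !mxE; field.
  by rewrite gt_eqF.
have A0 : A = pt 0 0 by rewrite /pt !scale0r !addr0.
have A11 : A1 = pt 1 1 by rewrite /A1 /pt !scale1r addrA.
have Bn : B = pt n.+2%:R n.+2%:R by rewrite /pt BE scalerDr addrA.
have segAB p : segment A B p <-> exists2 x, 0 <= x <= n.+2%:R & p = pt x x.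
  by rewrite {1}A0 {1}Bn; apply: seg_pt.
have segAA1 p : segment A A1 p <-> exists2 x, 0 <= x <= 1 & p = pt x x.
  by rewrite {1}A0 A11; apply: seg_pt.
have segA1B p : segment A1 B p <-> exists2 x, 1 <= x <= n.+2%:R & p = pt x x.
  by rewrite A11 {1}Bn; apply: seg_pt; rewrite ltr1n.
have [||sC iC _] := @triangle_insert R A A1 C (B :: r) ss1.
- by rewrite CA A1A; exact: independent_tooth.
- move=> p [tp]; rewrite car1 => cp.
  have {}tp : tooth f g A 0 (side 0%N) p.
    by apply: tooth_triangle; rewrite -addrA.
  have /segAB[x x0 px] := disj 0%N isT p (conj tp cp).
  have [x' [y' [x'1 y'1 _]]] := tp; rewrite px => /pt_inj[xx' _].
  by apply/segAA1; exists x => //; rewrite xx'.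
have rotE1 : rot 2 (A :: C :: A1 :: B :: r) = A1 :: B :: r ++ [:: A; C].
  by [].
have sz2 : (2 <= size (A :: C :: A1 :: B :: r))%N by [].
have sr := simple_polygon_rot sz2 sC; rewrite rotE1 in sr.
have cr := carrier_rot sz2; rewrite rotE1 in cr.
have [||z [ez sz iz]] := IH A1 B (r ++ [:: A; C]) (side \o succn) _ sr.
- by rewrite BE /A1; apply/rowP => i; rewrite !mxE; ring.
- move=> l ln p [tp]; rewrite cr carrier_head tail_carrier_insert => cp.
  have [x [y [/andP[xl xl1] /andP[yl yl1] sxy px]]] := tp.
  have l0 : 0 <= (l%:R : R) by rewrite ler0n.
  have {}px : p = pt (x + 1) (y + 1) by rewrite px /pt /A1; vec_ring.
  have corner a b : a <= 1 -> b <= 1 -> p = pt a b -> segment A1 B p.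
    move=> a1 b1 pab; have [xa yb] := pt_inj _ _ _ _ (etrans (esym px) pab).
    apply/segA1B; exists 1; first by rewrite lexx ler1n.
    by rewrite pab; congr pt; lra.
  have CE : C = if side 0%N then pt 1 0 else pt 0 1.
    by rewrite /C /pt; case: (side 0%N); rewrite scale0r scale1r ?addr0.
  have [c0 [c1 [/andP[c00 c01] /andP[c10 c11] {}CE]]] :
      exists c0 c1 : R, [/\ 0 <= c0 <= 1, 0 <= c1 <= 1 & C = pt c0 c1].
    rewrite CE; case: (side 0%N); [exists 1, 0 | exists 0, 1];
    by rewrite ?lexx ?ler01.
  case: cp => [[u /andP[u0 u1] pu]|].
    apply: (corner (u * c0) (u * c1)); [exact: mulr_ile1 | exact: mulr_ile1 |].
    by rewrite pu A0 CE /pt; vec_ring.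
  rewrite tail_carrier_insert => -[[u /andP[u0 u1] pu]|[//|cp]].
    have conv c : c <= 1 -> (1 - u) * c + u <= 1.
      move=> cle; rewrite -lerBrDr -[leRHS]mulr1.
      by rewrite ler_wpM2l ?subr_ge0.
    apply: (corner ((1 - u) * c0 + u) ((1 - u) * c1 + u)); [exact: conv.. |].
    by rewrite pu A11 CE /pt; vec_ring.
  have tp1 : tooth f g A l.+1 (side l.+1) p.
    exists (x + 1), (y + 1); split=> //.
    + by rewrite -(natr1 l.+1) -{1}(natr1 l) !lerD2r xl.
    + by rewrite -(natr1 l.+1) -{1}(natr1 l) !lerD2r yl.
    + by move: sxy => /=; case: (side l.+1); rewrite lerD2r.
  have cp1 : carrier (A :: B :: r) p by rewrite carrier_head; right.
  have /segAB[w /andP[w0 wn] pw] := disj l.+1 ln p (conj tp1 cp1).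
  apply/segA1B; exists w => //; rewrite wn andbT.
  by have [<- _] := pt_inj _ _ _ _ (etrans (esym px) pw); lra.
have rotE2 : rot (size (A1 :: z ++ B :: r))
    (A1 :: z ++ B :: r ++ [:: A; C]) = A :: C :: A1 :: z ++ B :: r.
  have -> : A1 :: z ++ B :: r ++ [:: A; C] = (A1 :: z ++ B :: r) ++ [:: A; C].
    by rewrite /= -catA.
  exact: rot_size_cat.
have szle : (size (A1 :: z ++ B :: r) <=
    size (A1 :: z ++ B :: r ++ [:: A; C]))%N.
  by rewrite /= !size_cat /= size_cat; lia.
have s2 := simple_polygon_rot szle sz; rewrite rotE2 in s2.
have c2 := carrier_rot szle; rewrite rotE2 in c2.
exists (C :: A1 :: z); split=> //=.
- by rewrite CA A1C ez; case: (side 0%N); rewrite !eqxx ?orbT.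
- rewrite c2; apply: ambient_isotopic_trans iz; rewrite cr -car1.
  exact: iC.
Qed.

End Refinement.

(** * Replacing an edge by a zigzag *)

Section Zigzag.
Context (R : realType).
Implicit Types (A B C p f g : 'rV[R]_3) (r s z : seq 'rV[R]_3).

(** The ray spanned by p cannot enter the sectors on both sides of the diagonal
    f + g. *)
Lemma free_side f g p : independent f g -> exists b : bool,
  forall x y l : R, 0 <= x -> 0 <= y -> (if b then y <= x else x <= y) ->
  0 <= l -> x *: f + y *: g = l *: p -> x = y.
Proof.
move=> fg; have [[x [y [l [y0 yx l0 E]]]]|no] := pselect (exists x y l : R,
    [/\ 0 <= y, y < x, 0 <= l & x *: f + y *: g = l *: p]); last first.
  exists true => x y l x0 y0 yx l0 E; apply/eqP; rewrite eq_le yx andbT leNgt.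
  by apply/negP => lt_yx; apply: no; exists x, y, l.
exists false => x' y' l' x'0 y'0 xy' l'0 E'.
have lpos : 0 < l.
  rewrite lt_neqAle l0 andbT; apply/eqP => l00.
  have [x00 _] : x = 0 /\ y = 0 by apply: fg; rewrite E -l00 scale0r.
  by move: yx; rewrite x00 ltNge y0.
have [Ex Ey] : l' * x = l * x' /\ l' * y = l * y'.
  apply: (independent_inj fg).
  by rewrite -!scalerA -!scalerDr E E' !scalerA mulrC.
apply/eqP; rewrite eq_le xy' /= -(ler_pM2l lpos) -Ex -Ey.
by rewrite ler_wpM2l // ltW.
Qed.

(** For N large, the teeth are so thin that they can meet only the two edges next
    to AB. Those edges leave one side of AB free near their end of AB. The teeth
    are put on the side that is free near A up to the midpoint Mid, and on the side
    that is free near B from there on. *)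
Lemma zigzag_edge f g A B r :
  independent f g -> B - A = f + g -> simple_polygon (A :: B :: r) ->
  exists2 N, (0 < N)%N & exists z,
  [/\ path (fun a b => (b - a == N%:R^-1 *: f) || (b - a == N%:R^-1 *: g))
        A (rcons z B),
    simple_polygon (A :: z ++ B :: r) &
    ambient_isotopic (carrier (A :: B :: r)) (carrier (A :: z ++ B :: r))].
Proof.
move=> fg BA ss; set s := A :: B :: r.
pose n := size s.
have n3 : (2 < n)%N by case: ss.
have vA : vertex s 0 = A by rewrite /vertex modn_small.
have vB : vertex s 1 = B by rewrite /vertex modn_small.
have vn : vertex s n = A by rewrite /vertex modnn.
pose Mid := (1 - 2^-1) *: A + 2^-1 *: B.
have [e1 e10 e1P] : exists2 e, 0 < e & forall i, (i < n)%N ->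
    (0 < i < n.-1)%N -> forall u v, 0 <= u <= 1 -> 0 <= v <= 1 ->
    e <= `|(1 - u) *: A + u *: Mid - edge_point s i v|.
  apply: finite_uniform => [i e e' eP e'e il u v u01 v01|i iltn].
    exact: le_trans e'e (eP il u v u01 v01).
  have [/andP[i0 il]|] := boolP (0 < i < n.-1)%N; last by exists 1.
  have [|e e0 eP] := @segments_distance R A Mid (vertex s i) (vertex s i.+1).
    move=> u v /andP[u0 u1] v01.
    have -> : (1 - u) *: A + u *: Mid = edge_point s 0 (u / 2).
      by rewrite /edge_point vA vB /Mid; apply/rowP => k; rewrite !mxE; field.
    have [j [w [w01 Ej cj]]] := edge_point_half_open s i v01.
    move=> E; have u2 : 0 <= u / 2 < 1 by apply/andP; split; lra.
    have [+ _] := simple_polygon_inj ss u2 w01 (etrans E Ej).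
    rewrite mod0n; case: cj => -[-> _]; rewrite modn_small //.
    by move=> i00; rewrite -i00 in i0.
  by exists e => // _ u v u01 v01; apply: eP.
have [e2 e20 e2P] : exists2 e, 0 < e & forall i, (i < n)%N ->
    (1 < i)%N -> forall u v, 0 <= u <= 1 -> 0 <= v <= 1 ->
    e <= `|(1 - u) *: Mid + u *: B - edge_point s i v|.
  apply: finite_uniform => [i e e' eP e'e il u v u01 v01|i iltn].
    exact: le_trans e'e (eP il u v u01 v01).
  have [i1|] := boolP (1 < i)%N; last by exists 1.
  have [|e e0 eP] := @segments_distance R Mid B (vertex s i) (vertex s i.+1).
    move=> u v u01 v01.
    have -> : (1 - u) *: Mid + u *: B = edge_point s 0 ((1 + u) / 2).
      by rewrite /edge_point vA vB /Mid; apply/rowP => k; rewrite !mxE; field.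
    have h01 : 0 <= (1 + u) / 2 <= 1.
      by move: u01 => /andP[u0 u1]; apply/andP; split; lra.
    have [k [h [h01' Ek ck]]] := edge_point_half_open s 0 h01.
    have [j [w [w01 Ej cj]]] := edge_point_half_open s i v01.
    move=> E.
    have [] := simple_polygon_inj ss h01' w01 (etrans (esym Ek) (etrans E Ej)).
    case: cj => -[-> ->]; case: ck => -[-> ->].
    - by rewrite mod0n modn_small // => i00; rewrite -i00 in i1.
    - by rewrite !modn_small // => i00; rewrite -i00 in i1.
    - by move: u01 => /andP[u0 u1] _; lra.
    - move=> /modn_succ_inj; rewrite mod0n modn_small // => i00.
      by rewrite -i00 in i1.
  by exists e => // _ u v u01 v01; apply: eP.
(* The side free near B is found by reading AB from B, hence the negation of bb
   in the choice of the teeth. *)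
have [ba baP] := free_side (vertex s n.-1 - A) fg.
have [bb bbP] := free_side (B - vertex s 2) fg.
pose e := Num.min e1 e2.
have e0 : 0 < e by rewrite lt_min e10.
(* N = 2 M teeth, so that the midpoint is a vertex of the zigzag. *)
pose M := (Num.truncn (`|g| / e)).+1.
have MP : `|g| < e * M%:R.
  by rewrite mulrC -ltr_pdivrMr // truncnS_gt.
have M0 : 0 < (M%:R : R) by rewrite ltr0n.
pose N := M.*2.
have N0 : 0 < (N%:R : R) by rewrite ltr0n double_gt0.
have NM : (N%:R : R) = 2 * M%:R by rewrite /N -mul2n natrM.
have Nn0 : (N%:R : R) != 0 by rewrite gt_eqF.
exists N; first by rewrite double_gt0.
apply: (@zigzag_teeth R _ _ N.-1 A B r
  (fun l => if (l < M)%N then ba else ~~ bb)) => //.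
- move=> x y; rewrite !scalerA => /fg[/eqP + /eqP].
  by rewrite !mulf_eq0 !invr_eq0 (negbTE Nn0) !orbF => /eqP -> /eqP ->.
- rewrite prednK ?double_gt0 // -scalerDr scalerA divff // scale1r -BA.
  by rewrite addrC subrK.
move=> l lN p [[x [y [/andP[lx xl] /andP[ly yl] sxy pxy]]]].
rewrite -/s carrier_head => -[//|[i [u [/andP[i0 iltn] u01 pE]]]].
rewrite -/s -/n in iltn pE.
pose a := x / N%:R; pose b := y / N%:R.
have l0 : 0 <= (l%:R : R) by rewrite ler0n.
have lN' : (l.+1%:R : R) <= N%:R.
  by rewrite ler_nat; move: lN; rewrite -ltnS prednK ?double_gt0.
have {}pxy : p = A + a *: f + b *: g by rewrite pxy !scalerA.
have xa : x = a * N%:R by rewrite /a divfK.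
have yb : y = b * N%:R by rewrite /b divfK.
have a0 : 0 <= a by rewrite divr_ge0 // (le_trans l0).
have b0 : 0 <= b by rewrite divr_ge0 // (le_trans l0).
have a1 : a <= 1 by rewrite ler_pdivrMr // mul1r (le_trans xl).
have b1 : b <= 1 by rewrite ler_pdivrMr // mul1r (le_trans yl).
have diag : a = b -> segment A B p.
  move=> ab; exists a; first by rewrite a0.
  rewrite pxy -ab -addrA -scalerDr -BA; vec_ring.
have close q : q = A + a *: (f + g) -> e <= `|q - p| -> False.
  move=> ->; rewrite pxy.
  have -> : A + a *: (f + g) - (A + a *: f + b *: g) = (a - b) *: g by vec_ring.
  rewrite normrZ => eab.
  have abN : `|a - b| * N%:R <= 1.
    rewrite -(ger0_norm (ltW N0)) -normrM mulrBl -xa -yb.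
    by rewrite ler_norml; move: lx xl ly yl; rewrite -natr1; lra.
  have : e * N%:R <= `|g|.
    apply: (le_trans (ler_wpM2r (ltW N0) eab)); rewrite mulrAC.
    by rewrite -[leRHS]mul1r ler_wpM2r.
  by rewrite NM; nra.
(* A point of the tooth on edge n - 1 or edge 1 lies on the diagonal; it is too
   close to AB to lie on another edge. *)
have [lM|Ml] := ltnP l M.
  rewrite lM in sxy.
  have [iE|in1] := eqVneq i n.-1.
    apply: diag; case/andP: u01 => u0 u1.
    apply: (baP a b (1 - u)) => //.
    - by move: sxy; case: ba {baP}; rewrite xa yb ler_pM2r.
    - by rewrite subr_ge0.
    - have : p - A = a *: f + b *: g by rewrite pxy; vec_ring.
      move=> <-; rewrite pE /edge_point iE prednK // vn.
      by vec_ring.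
  exfalso; have a2 : a <= 2^-1.
    rewrite ler_pdivrMr // NM mulKf // (le_trans xl) // ler_nat //.
  apply: (close ((1 - 2 * a) *: A + (2 * a) *: Mid)).
    by rewrite -BA /Mid; apply/rowP => k; rewrite !mxE; field.
  rewrite pE; apply: (@le_trans _ _ e1); first by rewrite /e ge_min lexx.
  apply: e1P => //; first by apply/andP; split=> //; rewrite ltn_neqAle in1; exact: iltn.
  by apply/andP; split; lra.
have lM : (l < M)%N = false by rewrite ltnNge Ml.
rewrite lM in sxy.
have [i1|i1] := eqVneq i 1%N.
  apply: diag; case/andP: u01 => u0 u1.
  suff : 1 - a = 1 - b by move=> h; lra.
  apply: (bbP _ _ u); rewrite ?subr_ge0 //.
  - move: sxy; case: bb {bbP} => /=; rewrite xa yb ler_pM2r // => h;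
    by rewrite lerD2l lerN2.
  - have : B - p = (1 - a) *: f + (1 - b) *: g.
      by rewrite pxy -[B](subrK A) BA; vec_ring.
    by move=> <-; rewrite pE /edge_point i1 vB; vec_ring.
exfalso; have a2 : 2^-1 <= a.
  by rewrite ler_pdivlMr // NM mulKf // (le_trans _ lx) // ler_nat.
apply: (close ((1 - (2 * a - 1)) *: Mid + (2 * a - 1) *: B)).
  by rewrite -BA /Mid; apply/rowP => k; rewrite !mxE; field.
rewrite pE; apply: (@le_trans _ _ e2); first by rewrite /e ge_min lexx orbT.
apply: e2P => //; first by rewrite ltn_neqAle eq_sym i1.
by apply/andP; split; lra.
Qed.

End Zigzag.

(** * From polygons to rectilinear integer polygons *)

Lemma cycleP (R : realType) (e : rel 'rV[R]_3) (s : seq 'rV[R]_3) :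
  reflect (forall i, (i < size s)%N -> e (vertex s i) (vertex s i.+1))
    (cycle e s).
Proof.
case: s => [|x s]; first by apply: (iffP idP).
apply: (iffP (pathP 0 (x := x) (p := rcons s x) (e := e))); rewrite size_rcons.
  all: move=> H i ilt; have := H i ilt.
  all: have -> : vertex (x :: s) i = (x :: rcons s x)`_i
    by rewrite /vertex modn_small //= -rcons_cons nth_rcons /= ilt.
  all: suff -> : vertex (x :: s) i.+1 = (rcons s x)`_i by [].
  all: rewrite /vertex nth_rcons; move: ilt; rewrite /= ltnS leq_eqVlt.
  all: case/predU1P => [->|ilt]; first by rewrite modnn /= ltnn eqxx.
  all: by rewrite modn_small //= ilt.
Qed.

Section Rectilinear.
Context (R : realType).
Implicit Types (A B v w : 'rV[R]_3) (r s z : seq 'rV[R]_3) (i j : 'I_3).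

Lemma coord_neq0 v : v != 0 -> exists j, v 0 j != 0.
Proof.
move=> v0; apply/existsP; apply: contraNT v0 => /existsPn v0.
by apply/eqP/rowP => j; rewrite mxE; apply/eqP; have := v0 j; rewrite negbK.
Qed.

(** An edge vector is the sum of its i-th component and of the rest; a zigzag
    uses multiples of these two vectors only. *)
Lemma split_refines_edge (E : pred 'rV[R]_3) i A B :
  (forall c, E (c *: delta_mx 0 i)) ->
  (forall c, E (c *: (B - A - (B - A) 0 i *: delta_mx 0 i))) ->
  refines_edge (fun a b => E (b - a)) A B.
Proof.
set f := _ *: delta_mx 0 i; set g := _ - f => Ef Eg r ss.
have BA : B - A = f + g by rewrite /g [RHS]addrC subrK.
have trivial : E (B - A) -> exists z,
    [/\ path (fun a b => E (b - a)) A (rcons z B),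
    simple_polygon (A :: z ++ B :: r) &
    ambient_isotopic (carrier (A :: B :: r)) (carrier (A :: z ++ B :: r))].
  move=> EBA; exists [::]; rewrite /= andbT; split=> //.
  exact: ambient_isotopic_refl.
have [f0|fn0] := eqVneq ((B - A) 0 i) 0.
  apply: trivial; have := Eg 1; rewrite scale1r.
  by rewrite {1}BA /f f0 scale0r add0r.
have [g0|/coord_neq0[j gj]] := eqVneq g 0.
  by apply: trivial; rewrite BA g0 addr0; apply: Ef.
have fg : independent f g.
  move=> a b /rowP ab.
  have gi : g 0 i = 0 by rewrite /g /f !mxE !eqxx mulr1 subrr.
  have a0 : a = 0.
    have := ab i; rewrite mxE [(b *: g) 0 i]mxE gi mulr0 addr0 /f !mxE !eqxx.
    move/eqP; rewrite mulr1 mulf_eq0 => /orP[/eqP //|].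
    by move: fn0; rewrite !mxE => /negbTE ->.
  split=> //; have := ab j; rewrite a0 scale0r add0r [(b *: g) 0 j]mxE [RHS]mxE.
  by move=> /eqP; rewrite mulf_eq0 (negbTE gj) orbF => /eqP.
have [N _ [z [ez sz iz]]] := zigzag_edge fg BA ss.
exists z; split=> //; apply: sub_path ez => a b /orP[]/eqP ->.
  by rewrite /f scalerA; apply: Ef.
exact: Eg.
Qed.

Definition ord_x : 'I_3 := @Ordinal 3 0 isT.
Definition ord_y : 'I_3 := @Ordinal 3 1 isT.
Definition ord_z : 'I_3 := @Ordinal 3 2 isT.

Lemma coordP (P : 'I_3 -> Prop) :
  P ord_x -> P ord_y -> P ord_z -> forall i, P i.
Proof.
move=> P0 P1 P2 [[|[|[|//]]] h].
- by rewrite (_ : Ordinal h = ord_x) //; apply/val_inj.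
- by rewrite (_ : Ordinal h = ord_y) //; apply/val_inj.
- by rewrite (_ : Ordinal h = ord_z) //; apply/val_inj.
Qed.

Definition axial v : bool := [exists i, [forall j, (j != i) ==> (v 0 j == 0)]].

Lemma axial_scale_delta i c : axial (c *: delta_mx 0 i).
Proof.
apply/existsP; exists i; apply/forallP => j; apply/implyP => /negbTE ji.
by rewrite !mxE ji mulr0.
Qed.

(** Splitting off the x-component leaves edges that are parallel to the x-axis or
    orthogonal to it; splitting off the y-component of the latter leaves edges
    parallel to an axis. *)
Lemma axial_isotopic s : simple_polygon s ->
  exists s', [/\ simple_polygon s', ambient_isotopic (carrier s) (carrier s') &
    cycle (fun a b => axial (b - a)) s'].
Proof.
move=> ss; pose E v := (v 0 ord_x == 0) || axial v.
have [||s1 [ss1 i1 E1]] :=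
    @refine_polygon R (fun _ _ => true) (fun a b => E (b - a)) s _ ss.
- move=> A B _; apply: (@split_refines_edge E ord_x) => c; rewrite /E.
    by rewrite axial_scale_delta orbT.
  by rewrite !mxE /= mulr1 subrr mulr0 eqxx.
- by apply/cycleP.
have [|s2 [ss2 i2 E2]] := @refine_polygon R (fun a b => E (b - a))
    (fun a b => axial (b - a)) s1 _ ss1 E1; last first.
  by exists s2; split=> //; apply: ambient_isotopic_trans i2.
move=> A B /orP[/eqP v0|ax]; last first.
  move=> r sr; exists [::]; rewrite /= andbT; split=> //.
  exact: ambient_isotopic_refl.
apply: (@split_refines_edge _ ord_y) => c; first exact: axial_scale_delta.
apply/existsP; exists ord_z; apply/forallP; apply: coordP => //=.
  move: v0; rewrite !mxE /= => ->.
  by rewrite !(mulr0, subr0, oppr0) eqxx.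
by rewrite !mxE /= mulr1 subrr mulr0 eqxx.
Qed.

Definition int_point v : bool := [forall i, v 0 i \is a Num.int].

(** Rounding every coordinate to a multiple of 1/N is a small move, and keeps the
    edges parallel to the axes since equal coordinates remain equal. Scaling by N
    then makes the vertices integer. *)
Lemma int_axial_isotopic s : simple_polygon s ->
  exists s', [/\ simple_polygon s', ambient_isotopic (carrier s) (carrier s'),
    all int_point s' & cycle (fun a b => axial (b - a)) s'].
Proof.
move=> /axial_isotopic[s1 [ss1 i1 ax1]].
have [e e0 eP] := simple_polygon_perturbation ss1.
pose N : R := (Num.truncn e^-1).+1%:R.
have N0 : 0 < N by rewrite ltr0n.
have Ne : N^-1 <= e.
  by rewrite invf_ple ?posrE // ltW // truncnS_gt.
pose F v : 'rV[R]_3 := \row_i (Num.floor (N * v 0 i))%:~R.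
pose s2 := map (fun v => N^-1 *: F v) s1.
have [||ss2 i2 _] := eP s2; first by rewrite size_map.
  have spos : (0 < size s1)%N by case: ss1; lia.
  move=> i; rewrite /vertex size_map (nth_map 0) ?ltn_mod //.
  set v := nth _ _ _; apply: norm_le_coord => [|j]; first exact: ltW.
  rewrite !mxE (le_trans _ Ne) // -[leRHS]mul1r ler_pdivlMr //.
  rewrite -[X in _ * X](gtr0_norm N0) -normrM mulrBl mulrAC mulVf ?gt_eqF //.
  rewrite mul1r (mulrC (v 0 j)) distrC ler_norml.
  have := floor_le_tmp (N * v 0 j); have := floorD1_gt (N * v 0 j).
  rewrite intrD; lra.
have N1 : 1 <= N by rewrite ler1n.
have [||ss3 i3] := @linear_motion R (fun v => N *: v) s2 _ _ ss2.
- by move=> a x y; rewrite scalerDr !scalerA mulrC.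
- move=> t x /andP[t0 t1] /eqP; rewrite scalerA -scalerDl scaler_eq0.
  case/orP => /eqP // E; exfalso.
  by have := ler_wpM2l t0 N1; lra.
have E3 : map (fun v => N *: v) s2 = map F s1.
  rewrite /s2 -map_comp; apply: eq_map => v /=.
  by rewrite scalerA mulfV ?gt_eqF // scale1r.
rewrite E3 in ss3 i3; exists (map F s1); split=> //.
- apply: ambient_isotopic_trans i3; exact: ambient_isotopic_trans i2.
- rewrite all_map; apply/allP => v _ /=; apply/forallP => j.
  by rewrite mxE intr_int.
rewrite cycle_map; apply: sub_cycle ax1 => a b /= /existsP[i /forallP abi].
apply/existsP; exists i; apply/forallP => j; apply/implyP => ji.
have := abi j; rewrite ji /= !mxE !subr_eq0 => /eqP ->; by [].
Qed.

Lemma unit_steps u m A B r : B = A + m.+1%:R *: u ->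
  simple_polygon (A :: B :: r) ->
  exists z, [/\ path (fun a b => b - a == u) A (rcons z B),
    simple_polygon (A :: z ++ B :: r) &
    ambient_isotopic (carrier (A :: B :: r)) (carrier (A :: z ++ B :: r))].
Proof.
elim: m => [|m IH] in A B r *.
  rewrite scale1r => BE ss; exists [::]; split=> //=.
    by rewrite BE addrC addKr eqxx.
  exact: ambient_isotopic_refl.
move=> BE ss; pose A1 := A + u.
have m2 : 0 < m.+2%:R :> R by rewrite ltr0n.
have A1E : A1 = (1 - m.+2%:R^-1) *: A + m.+2%:R^-1 *: B.
  rewrite BE /A1; move: (m.+2%:R : R) (lt0r_neq0 m2) => a a0.
  by apply/rowP => i; rewrite !mxE; field.
have l01 : 0 < (m.+2%:R^-1 : R) < 1.
  by rewrite invr_gt0 m2 invf_lt1 // ltr1n.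
have [ss1 car1] := simple_polygon_subdivide l01 ss.
rewrite -A1E in ss1 car1.
have sz1 : (1 <= size (A :: A1 :: B :: r))%N by [].
have rotE1 : rot 1 (A :: A1 :: B :: r) = A1 :: B :: r ++ [:: A].
  by [].
have sr := simple_polygon_rot sz1 ss1; rewrite rotE1 in sr.
have cr := carrier_rot sz1; rewrite rotE1 in cr.
have [|z [ez sz iz]] := IH A1 B (r ++ [:: A]) _ sr.
  by rewrite BE /A1; apply/rowP => i; rewrite !mxE; ring.
have rotE2 : rot (size (A1 :: z ++ B :: r))
    (A1 :: z ++ B :: r ++ [:: A]) = A :: A1 :: z ++ B :: r.
  have -> : A1 :: z ++ B :: r ++ [:: A] = (A1 :: z ++ B :: r) ++ [:: A].
    by rewrite /= -catA.
  exact: rot_size_cat.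
have szle : (size (A1 :: z ++ B :: r) <= size (A1 :: z ++ B :: r ++ [:: A]))%N.
  by rewrite /= !size_cat /= size_cat; lia.
have s2 := simple_polygon_rot szle sz; rewrite rotE2 in s2.
have e2 := carrier_rot szle; rewrite rotE2 in e2.
exists (A1 :: z); split=> //=; first by rewrite ez /A1 addrC addKr eqxx.
by rewrite e2 -car1 -cr.
Qed.

End Rectilinear.

(** * Every knot has a cubic polygon *)

Section CubicPolygon.
Context (R : realType).
Implicit Types (A B v w u : 'rV[R]_3) (r s z : seq 'rV[R]_3) (i j : 'I_3).

Definition lattice_edgeb (L : lattice R) : rel 'rV[R]_3 :=
  fun a b => `[< lattice_edge L a b >].

Lemma lattice_polygonP (L : lattice R) s :
  lattice_polygon L s <-> simple_polygon s /\ cycle (lattice_edgeb L) s.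
Proof.
split=> -[ss Ls]; split=> //; last by move=> i /(elimT (cycleP _ _) Ls)/asboolP.
by apply/cycleP => i /Ls ?; apply/asboolP.
Qed.

Lemma int_spanE (a b c p : 'rV[R]_3) :
  int_span a b c p <-> exists k l m : int,
    p = k%:~R *: a + l%:~R *: b + m%:~R *: c.
Proof.
by split=> -[k [l [m ->]]]; exists k, l, m; rewrite !scaler_int.
Qed.

Lemma vec3_delta :
  [/\ vec3 1 0 0 = delta_mx 0 ord_x :> 'rV[R]_3,
      vec3 0 1 0 = delta_mx 0 ord_y :> 'rV[R]_3 &
      vec3 0 0 1 = delta_mx 0 ord_z :> 'rV[R]_3].
Proof. by split; apply/rowP; apply: coordP; rewrite !mxE. Qed.

Lemma cubic_pointP v : lattice_point (cubic_lattice R) v <-> int_point v.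
Proof.
apply: (iff_trans (int_spanE _ _ _ _)); split.
  move=> [k [l [m ->]]]; apply/forallP; apply: coordP;
    by rewrite !mxE /= !(mulr0, mulr1, addr0, add0r) intr_int.
move=> /forallP vi; have /intrP[k kE] := vi ord_x; have /intrP[l lE] := vi ord_y.
have /intrP[m mE] := vi ord_z; exists k, l, m; apply/rowP; apply: coordP;
  by rewrite !mxE /= !(mulr0, mulr1, addr0, add0r).
Qed.

Lemma cubic_stepP v : v \in lattice_step (cubic_lattice R) <->
  exists i, v = delta_mx 0 i.
Proof.
have [E0 E1 E2] := vec3_delta.
rewrite /= !inE E0 E1 E2; split.
  by case/or3P=> /eqP ->; [exists ord_x | exists ord_y | exists ord_z].
by move=> [i ->]; move: i; apply: coordP; rewrite eqxx ?orbT.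
Qed.

Lemma cubic_edgeP v w : lattice_edge (cubic_lattice R) v w <->
  [/\ int_point v, int_point w &
    exists i, w - v = delta_mx 0 i \/ w - v = - delta_mx 0 i].
Proof.
split=> [[/cubic_pointP v1 /cubic_pointP w1 [d /cubic_stepP[i ->]]]|].
  by split=> //; exists i.
move=> [/cubic_pointP v1 /cubic_pointP w1 [i vw]]; split=> //.
by exists (delta_mx 0 i) => //; apply/cubic_stepP; exists i.
Qed.

Lemma int_pointD v w : int_point v -> int_point w -> int_point (v + w).
Proof.
move=> /forallP vi /forallP wi; apply/forallP => i.
by rewrite mxE rpredD.
Qed.

Lemma int_pointN v : int_point v -> int_point (- v).
Proof. by move=> /forallP vi; apply/forallP => i; rewrite mxE rpredN. Qed.

Lemma int_point_delta i : int_point (delta_mx 0 i : 'rV[R]_3).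
Proof. by apply/forallP => j; rewrite mxE natr_int. Qed.

Lemma axial_refines_edge A B : int_point A -> int_point B -> axial (B - A) ->
  refines_edge (lattice_edgeb (cubic_lattice R)) A B.
Proof.
move=> iA iB /existsP[i /forallP ax] r ss.
have AB : A <> B.
  by have := @simple_polygon_vertex_neq R _ 0 ss; rewrite /vertex !modn_small.
have BA : B - A = (B - A) 0 i *: delta_mx 0 i.
  apply/rowP => j; rewrite [RHS]mxE [delta_mx _ _ _ _]mxE eqxx /=.
  have [->|ji] := eqVneq j i; first by rewrite mulr1.
  by rewrite mulr0; apply/eqP; have := ax j; rewrite ji.
have /forallP/(_ i)/intrP[k kE] := int_pointD iB (int_pointN iA).
have [u [m [uE mE]]] : exists u m,
    (u = delta_mx 0 i \/ u = - delta_mx 0 i) /\ B - A = m.+1%:R *: u.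
  rewrite BA kE; case: k kE => [[|m]|m] kE.
  - by case: AB; apply/esym/eqP; rewrite -subr_eq0 BA kE scale0r.
  - by exists (delta_mx 0 i), m; split; [left | ].
  - exists (- delta_mx 0 i), m; split; first by right.
    by rewrite NegzE mulrNz scaleNr scalerN.
have iu : int_point u.
  by case: uE => ->; [|apply: int_pointN]; apply: int_point_delta.
have [|z [ez sz iz]] := @unit_steps R u m A B r _ ss.
  by rewrite -mE addrC subrK.
exists z; split=> //.
move: (rcons z B) ez => t.
elim: t A iA {BA kE mE iz sz ss AB ax} => //= b t IH a ia.
case/andP=> /eqP ba et; have ib : int_point b.
  by rewrite -[b](subrK a) ba int_pointD.
rewrite IH // andbT; apply/asboolP/cubic_edgeP; split=> //.
by rewrite ba; exists i.
Qed.

Lemma cubic_polygon_isotopic s : simple_polygon s -> exists s',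
  lattice_polygon (cubic_lattice R) s' /\
  ambient_isotopic (carrier s) (carrier s').
Proof.
move=> /int_axial_isotopic[s1 [ss1 i1 int1 ax1]].
have [|||s2 [ss2 i2 e2]] := @refine_polygon R
  (fun a b => [&& int_point a, int_point b & axial (b - a)])
  (lattice_edgeb (cubic_lattice R)) s1.
- by move=> A B /and3P[]; apply: axial_refines_edge.
- exact: ss1.
- apply: sub_in_cycle int1 ax1 => a b ia ib ab.
  by apply/and3P; split.
exists s2; split; first by apply/lattice_polygonP.
exact: ambient_isotopic_trans i2.
Qed.

End CubicPolygon.

(** * Shortening a cubic polygon in the simple hexagonal lattice *)

Section Corner.
Context (R : realType).
Implicit Types (A B C v w u : 'rV[R]_3) (r s z : seq 'rV[R]_3) (i j : 'I_3).

Definition is_sign (x : R) : Prop := x = 1 \/ x = - 1.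

Lemma sign_neq0 x : is_sign x -> x <> 0.
Proof. by case=> -> /eqP; rewrite ?oppr_eq0 oner_eq0. Qed.

Lemma cubic_edge_sign v w : lattice_edge (cubic_lattice R) v w ->
  exists i x, is_sign x /\ w - v = x *: delta_mx 0 i.
Proof.
move=> /cubic_edgeP[_ _ [i [->|->]]].
  by exists i, 1; rewrite scale1r; split=> //; left.
by exists i, (- 1); rewrite scaleN1r; split=> //; right.
Qed.

Definition corner A C B i j : Prop :=
  i <> j /\ exists x y, [/\ is_sign x, is_sign y, C - A = x *: delta_mx 0 i &
    B - C = y *: delta_mx 0 j].

(** Consecutive parallel steps are equal, as a simple polygon does not fold back.
    If all steps were parallel, the polygon would therefore move away from its
    first vertex forever. *)
Lemma cubic_polygon_turns s : lattice_polygon (cubic_lattice R) s ->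
  exists k i j, corner (vertex s k) (vertex s k.+1) (vertex s k.+2) i j.
Proof.
move=> [ss Ls].
have edge k : lattice_edge (cubic_lattice R) (vertex s k) (vertex s k.+1).
  have klt : (k %% size s < size s)%N by rewrite ltn_mod; case: ss; lia.
  have := Ls _ klt; rewrite vertex_mod.
  suff -> : vertex s (k %% size s).+1 = vertex s k.+1 by [].
  by rewrite -!edge_point1 edge_point_mod.
apply: contrapT => straight.
pose d k := vertex s k.+1 - vertex s k.
have step k : d k.+1 = d k.
  have [i [x [sx dx]]] := cubic_edge_sign (edge k).
  have [j [y [sy dy]]] := cubic_edge_sign (edge k.+1).
  have [ij|ij] := eqVneq i j; last first.
    case: straight; exists k, i, j; split; first exact/eqP.
    by exists x, y.
  have h01 : 0 <= (2^-1 : R) <= 1 by apply/andP; split; lra.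
  have [yx|yx] : y = x \/ y = - x.
    by case: sx sy => -> [] ->; rewrite ?opprK; [left|right|right|left].
    by rewrite /d dx dy -ij yx.
  case: (simple_polygon_corner (i := k) ss h01); rewrite dx dy -ij yx.
  by apply/rowP => l; rewrite !mxE; field.
have dE k : d k = d 0%N by elim: k => // k <-; apply: step.
have vE k : vertex s k = vertex s 0 + k%:R *: d 0%N.
  elim: k => [|k IH]; first by rewrite scale0r addr0.
  have -> : vertex s k.+1 = d k + vertex s k by rewrite subrK.
  by rewrite dE IH -natr1; vec_ring.
have := vE (size s); rewrite -vertex_mod modnn => /eqP.
rewrite -[X in X == _]addr0 (inj_eq (addrI _)) eq_sym scaler_eq0 pnatr_eq0.
case/orP => [/eqP sz0|]; first by case: ss; rewrite sz0.
by rewrite subr_eq0 => /eqP/esym; apply: simple_polygon_vertex_neq.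
Qed.

Lemma lattice_polygon_rot (L : lattice R) s k : (k <= size s)%N ->
  lattice_polygon L s -> lattice_polygon L (rot k s).
Proof.
move=> ks /lattice_polygonP[ss Ls]; apply/lattice_polygonP; split.
  exact: simple_polygon_rot.
by rewrite rot_cycle.
Qed.

Lemma cubic_polygon_corner s : lattice_polygon (cubic_lattice R) s ->
  exists A C B r i j, [/\ corner A C B i j,
    lattice_polygon (cubic_lattice R) (A :: C :: B :: r),
    size (A :: C :: B :: r) = size s &
    carrier (A :: C :: B :: r) = carrier s].
Proof.
move=> Ls; have [k [i [j cor]]] := cubic_polygon_turns Ls.
have spos : (0 < size s)%N by have [[]] := Ls; lia.
pose m := (k %% size s)%N.
have mle : (m <= size s)%N by rewrite ltnW // ltn_mod.
have Lr := lattice_polygon_rot mle Ls.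
have cr := carrier_rot mle; have sr := size_rot m s.
have vr l : vertex (rot m s) l = vertex s (k + l).
  by rewrite vertex_rot // -[LHS]vertex_mod /m modnDmr vertex_mod addnC.
case: (rot m s) Lr cr sr vr => [|A [|C [|B r]]] Lr cr sr vr;
  try by case: Lr => -[].
have AE : A = vertex s k by rewrite -[k]addn0 -vr /vertex modn_small.
have CE : C = vertex s k.+1 by rewrite -[k.+1]addn1 -vr /vertex modn_small.
have BE : B = vertex s k.+2 by rewrite -[k.+2]addn2 -vr /vertex modn_small.
by exists A, C, B, r, i, j; split=> //; rewrite AE BE CE.
Qed.

Lemma corner_coord A C B i j : corner A C B i j ->
  exists x y, [/\ is_sign x, is_sign y & forall a b, let p := A + a *: (C - A) + b *: (B - A) in
    p 0 i = A 0 i + (a + b) * x /\ p 0 j = A 0 j + b * y].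
Proof.
move=> [/eqP ij [x [y [sx sy CA BC]]]]; exists x, y; split=> // a b p.
have BA : B - A = x *: delta_mx 0 i + y *: delta_mx 0 j.
  by rewrite -CA -BC; vec_ring.
rewrite /p CA BA; split; rewrite !mxE !eqxx /=.
  by rewrite (negbTE ij) /=; ring.
by rewrite eq_sym (negbTE ij) /=; ring.
Qed.

Lemma corner_independent A C B i j : corner A C B i j ->
  independent (C - A) (B - A).
Proof.
move=> /corner_coord[x [y [/sign_neq0/eqP x0 /sign_neq0/eqP y0 E]]] a b ab.
have [Ei Ej] := E a b; move: Ei Ej; rewrite -addrA ab addr0.
move=> /eqP + /eqP; rewrite -[X in X == _ -> _]addr0 (inj_eq (addrI _)) eq_sym.
rewrite mulf_eq0 (negbTE x0) orbF => /eqP ab0.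
rewrite -[X in X == _ -> _]addr0 (inj_eq (addrI _)) eq_sym.
rewrite mulf_eq0 (negbTE y0) orbF => /eqP b0.
by split=> //; rewrite -ab0 b0 addr0.
Qed.

(** Only the coordinate along the axis of its edge can fail to be an integer. *)
Lemma cubic_carrier_int s p i j : lattice_polygon (cubic_lattice R) s ->
  carrier s p -> i <> j -> p 0 i \is a Num.int \/ p 0 j \is a Num.int.
Proof.
move=> [ss Ls] [k [u [klt u01 ->]]] /eqP ij.
have /cubic_edgeP[/forallP vi /forallP wi [l dl]] := Ls k klt.
have E a : a != l -> edge_point s k u 0 a = vertex s k 0 a.
  move=> /negbTE al.
  have : (vertex s k.+1 - vertex s k) 0 a = 0.
    by case: dl => ->; rewrite !mxE eqxx al ?oppr0.
  by rewrite /edge_point !mxE => /subr0_eq ->; ring.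
have [il|il] := eqVneq i l; last by left; rewrite E.
by right; rewrite E // -il eq_sym.
Qed.

Lemma int_unit_interval (x : R) : x \is a Num.int -> 0 <= x <= 1 ->
  x = 0 \/ x = 1.
Proof.
move=> /intrP[[[|[|m]]|m] ->] /andP[x0 x1]; [by left | by right | | ].
  by move: x1; rewrite (ler_int _ _ 1).
by move: x0; rewrite (ler_int _ 0).
Qed.

(** By cubic_carrier_int, one of the affine coordinates along the two steps is an
    integer on the polygon, while the points of the triangle where this happens
    are on the two steps. *)
Lemma corner_triangle A C B r i j : corner A C B i j ->
  lattice_polygon (cubic_lattice R) (A :: C :: B :: r) ->
  triangle A C B `&` carrier (A :: C :: B :: r) `<=`
    segment A C `|` segment C B.
Proof.
move=> cor Ls p [[a [b [a0 b0 ab1 pE]]] cp].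
have [x [y [sx sy E]]] := corner_coord cor.
have /forallP iA : int_point A.
  have /cubic_edgeP[iA _ _] := Ls.2 0%N isT.
  by move: iA; rewrite /vertex modn_small.
have [Ei Ej] := E a b; rewrite -pE in Ei Ej.
have signM (z t w : R) : is_sign z -> t \is a Num.int ->
    t + w * z \is a Num.int -> w \is a Num.int.
  move=> sz ti /rpredB/(_ ti); rewrite addrAC subrr add0r.
  by case: sz => ->; rewrite ?mulr1 // mulrN1 rpredN.
have [|] := cubic_carrier_int Ls cp cor.1.
  rewrite Ei => /(signM _ _ _ sx (iA i))/int_unit_interval[|ab|ab].
  - by rewrite addr_ge0.
  - left; exists 0; first by rewrite lexx ler01.
    have [a00 b00] : a = 0 /\ b = 0 by lra.
    by rewrite pE a00 b00; vec_ring.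
  - right; exists b; first by apply/andP; split; lra.
    have bE : b = 1 - a by lra.
    by rewrite pE bE; vec_ring.
rewrite Ej => /(signM _ _ _ sy (iA j))/int_unit_interval[|b00|b1].
- by apply/andP; split; lra.
- left; exists a; first by apply/andP; split; lra.
  by rewrite pE b00; vec_ring.
right; exists 1; first by rewrite lexx ler01.
have a00 : a = 0 by lra.
by rewrite pE a00 b1; vec_ring.
Qed.

(** The third step would have nonzero components along the axes of both other
    steps. *)
Lemma corner_not_triangle A C B i j : corner A C B i j ->
  ~ lattice_polygon (cubic_lattice R) [:: A; C; B].
Proof.
move=> cor [_ Ls]; have [x [y [sx sy E]]] := corner_coord cor.
have /cubic_edge_sign[k [z [sz]]] := Ls 2 isT.
rewrite /vertex modnn modn_small //= => BA.
have [Ei Ej] := E 0 1.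
have BE : B = A + 0 *: (C - A) + 1 *: (B - A) by vec_ring.
rewrite -BE add0r !mul1r in Ei Ej.
have ai : (A - B) 0 i = - x by rewrite !mxE Ei; ring.
have aj : (A - B) 0 j = - y by rewrite !mxE Ej; ring.
have [ik|/negbTE ik] := eqVneq i k.
  move: aj; rewrite BA -ik !mxE eqxx /=.
  have /eqP/negbTE := cor.1; rewrite eq_sym => -> /eqP.
  by rewrite mulr0 eq_sym oppr_eq0 => /eqP; exact: sign_neq0.
move: ai; rewrite BA !mxE eqxx ik mulr0 => /eqP.
by rewrite eq_sym oppr_eq0 => /eqP; exact: sign_neq0.
Qed.

End Corner.

Section Shortening.
Context (R : realType).
Implicit Types (A B C v w u : 'rV[R]_3) (r s : seq 'rV[R]_3) (i j : 'I_3).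

(** The indices are added modulo 3: this is a cyclic permutation of the axes. *)
Definition shift_axes v : 'rV[R]_3 := \row_j v 0 (j + 1).

Lemma shift_axes_linear a v w :
  shift_axes (a *: v + w) = a *: shift_axes v + shift_axes w.
Proof. by apply/rowP => i; rewrite !mxE. Qed.

(** The permutation is a rotation by a third of a turn, so that none of its
    eigenvalues is a negative real. Explicitly, eliminating two coordinates from
    the three equations leaves ((1 - t)^3 + t^3) v_i = 0. *)
Lemma shift_axes_motion t v : 0 <= t <= 1 ->
  (1 - t) *: v + t *: shift_axes v = 0 -> v = 0.
Proof.
move=> /andP[t0 t1] /rowP E.
have {}E i : (1 - t) * v 0 i + t * v 0 (i + 1) = 0.
  by have := E i; rewrite !mxE.
apply/rowP => i; rewrite mxE.
have i3 : i + 1 + 1 + 1 = i by move: i; apply: coordP; apply/val_inj.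
have := E i; have := E (i + 1); have := E (i + 1 + 1); rewrite i3.
move: (v 0 i) (v 0 (i + 1)) (v 0 (i + 1 + 1)) => a b c E2 E1 E0.
have : ((1 - t) ^+ 3 + t ^+ 3) * a =
    (1 - t) ^+ 2 * ((1 - t) * a + t * b) -
    (1 - t) * t * ((1 - t) * b + t * c) + t ^+ 2 * ((1 - t) * c + t * a).
  by ring.
rewrite E0 E1 E2 !mulr0 subr0 addr0 => /eqP; rewrite mulf_eq0.
case/orP => [/eqP|/eqP //]; have -> : (1 - t) ^+ 3 + t ^+ 3 =
  1 - 3 * t + 3 * t ^+ 2 by ring.
by have := sqr_ge0 (t - 2^-1); lra.
Qed.

Lemma shift_axes_delta i : shift_axes (delta_mx 0 (i + 1)) = delta_mx 0 i.
Proof. by apply/rowP => j; rewrite !mxE (inj_eq (addIr _)). Qed.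

Lemma shift_axesB v w : shift_axes (v - w) = shift_axes v - shift_axes w.
Proof. by rewrite -scaleN1r addrC shift_axes_linear scaleN1r addrC. Qed.

Lemma shift_axesZ a v : shift_axes (a *: v) = a *: shift_axes v.
Proof. by apply/rowP => i; rewrite !mxE. Qed.

Lemma shift_axes_polygon s : lattice_polygon (cubic_lattice R) s ->
  lattice_polygon (cubic_lattice R) (map shift_axes s) /\
  ambient_isotopic (carrier s) (carrier (map shift_axes s)).
Proof.
move=> /lattice_polygonP[ss Ls].
have [ss' is'] := linear_motion shift_axes_linear shift_axes_motion ss.
split=> //; apply/lattice_polygonP; split=> //; rewrite cycle_map.
apply: sub_cycle Ls => a b /asboolP/cubic_edgeP[/forallP ia /forallP ib [i ab]].
apply/asboolP/cubic_edgeP; split.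
- by apply/forallP => j; rewrite mxE.
- by apply/forallP => j; rewrite mxE.
exists (i - 1); rewrite -shift_axesB -shift_axes_delta subrK.
case: ab => ->; [by left | right].
by rewrite -scaleN1r shift_axesZ scaleN1r.
Qed.

Lemma shift_axes_corner A C B i j : corner A C B i j ->
  corner (shift_axes A) (shift_axes C) (shift_axes B) (i - 1) (j - 1).
Proof.
move=> [ij [x [y [sx sy CA BC]]]]; split; first by move=> /addIr.
exists x, y; split=> //.
  by rewrite -shift_axesB CA shift_axesZ -[in LHS](subrK 1 i) shift_axes_delta.
by rewrite -shift_axesB BC shift_axesZ -[in LHS](subrK 1 j) shift_axes_delta.
Qed.

(** The axis orthogonal to the plane of the corner becomes the z-axis after at
    most two cyclic permutations of the axes. *)
Lemma horizontal_corner s : lattice_polygon (cubic_lattice R) s ->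
  exists A C B r i j, [/\ corner A C B i j, i <> ord_z /\ j <> ord_z,
    lattice_polygon (cubic_lattice R) (A :: C :: B :: r),
    size (A :: C :: B :: r) = size s &
    ambient_isotopic (carrier s) (carrier (A :: C :: B :: r))].
Proof.
move=> /cubic_polygon_corner[A [C [B [r [i [j [cor Ls' sz cE]]]]]]].
have [Ls1 i1] := shift_axes_polygon Ls'; rewrite /= in Ls1 i1.
have [Ls2 i2] := shift_axes_polygon Ls1; rewrite /= in Ls2 i2.
have cor1 := shift_axes_corner cor; have cor2 := shift_axes_corner cor1.
have : [|| (i != ord_z) && (j != ord_z), (i - 1 != ord_z) && (j - 1 != ord_z) |
           (i - 1 - 1 != ord_z) && (j - 1 - 1 != ord_z)].
  by have /eqP := cor.1; move: i j {cor cor1 cor2}; apply: coordP; apply: coordP.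
rewrite -cE; case/or3P => /andP[/eqP ic /eqP jc].
- exists A, C, B, r, i, j; split=> //; exact: ambient_isotopic_refl.
- exists (shift_axes A), (shift_axes C), (shift_axes B), (map shift_axes r).
  by exists (i - 1), (j - 1); split=> //; rewrite -sz /= size_map.
exists (shift_axes (shift_axes A)), (shift_axes (shift_axes C)).
exists (shift_axes (shift_axes B)), (map shift_axes (map shift_axes r)).
exists (i - 1 - 1), (j - 1 - 1); split=> //; first by rewrite -sz /= !size_map.
exact: ambient_isotopic_trans i2.
Qed.

(** The linear map fixing the x- and z-axes that sends the unit vector of the
    y-axis to the step y of the hexagonal lattice if k = 1, and to its step
    z = y - x if k = -1. Both choices send the cubic lattice onto the hexagonal
    one. *)
Definition shear (k : R) v : 'rV[R]_3 :=
  vec3 (v 0 ord_x + k * v 0 ord_y / 2) (Num.sqrt 3 / 2 * v 0 ord_y) (v 0 ord_z).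

Lemma shear_linear k a v w : shear k (a *: v + w) = a *: shear k v + shear k w.
Proof. by apply/rowP; apply: coordP; rewrite !mxE /=; ring. Qed.

Lemma shear_motion k t v : 0 <= t <= 1 ->
  (1 - t) *: v + t *: shear k v = 0 -> v = 0.
Proof.
move=> /andP[t0 t1] /rowP E.
have s3 : 0 < Num.sqrt 3 :> R by rewrite sqrtr_gt0.
have v2 : v 0 ord_z = 0 by have := E ord_z; rewrite !mxE /=; lra.
have v1 : v 0 ord_y = 0.
  have := E ord_y; rewrite !mxE /= mulrA -mulrDl => /eqP; rewrite mulf_eq0.
  by case/orP => /eqP //; nra.
have v0 : v 0 ord_x = 0 by have := E ord_x; rewrite !mxE /= v1; lra.
by apply/rowP; apply: coordP; rewrite mxE.
Qed.

Lemma shear_edge k A B : is_sign k -> int_point A -> int_point B ->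
  (exists2 d, d \in lattice_step (sh_lattice R) &
     shear k (B - A) = d \/ shear k (B - A) = - d) ->
  lattice_edge (sh_lattice R) (shear k A) (shear k B).
Proof.
move=> sk iA iB [d dL BA].
have point v : int_point v -> lattice_point (sh_lattice R) (shear k v).
  move=> /forallP vi; apply/int_spanE.
  have /intrP[a aE] := vi ord_x; have /intrP[b bE] := vi ord_y.
  have /intrP[c cE] := vi ord_z; case: sk => ->.
    exists a, b, c; apply/rowP; apply: coordP;
      by rewrite !mxE /= ?aE ?bE ?cE; field.
  exists (a - b), b, c; apply/rowP; apply: coordP;
    by rewrite !mxE /= ?aE ?bE ?cE ?intrB; field.
split; [exact: point | exact: point | exists d => //].
suff <- : shear k (B - A) = shear k B - shear k A by [].
by rewrite -scaleN1r addrC shear_linear scaleN1r addrC.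
Qed.

Lemma shear_cubic_edge k A B : is_sign k ->
  lattice_edge (cubic_lattice R) A B ->
  lattice_edge (sh_lattice R) (shear k A) (shear k B).
Proof.
move=> sk /cubic_edgeP[iA iB [i BA]]; apply: shear_edge => //.
have shN v : shear k (- v) = - shear k v.
  by rewrite -scaleN1r -[_ *: v]addr0 shear_linear; apply/rowP; apply: coordP;
    rewrite !mxE /=; ring.
exists (shear k (delta_mx 0 i)); last first.
  by case: BA => ->; [left | right].
rewrite /= !inE; move: i {BA}; apply: coordP; apply/or4P.
- by apply: Or41; apply/eqP/rowP; apply: coordP; rewrite !mxE /=; field.
- by case: sk => ->; [apply: Or42 | apply: Or43];
    apply/eqP/rowP; apply: coordP; rewrite !mxE /=; field.
- by apply: Or44; apply/eqP/rowP; apply: coordP; rewrite !mxE /=; field.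
Qed.

(** For the right k, the diagonal of the corner is sent to a step: with k = 1,
    x - y becomes -z; with k = -1, x + y becomes x + z = y. *)
Lemma shear_corner A C B i j : corner A C B i j -> i <> ord_z -> j <> ord_z ->
  int_point A -> int_point B ->
  exists2 k, is_sign k & lattice_edge (sh_lattice R) (shear k A) (shear k B).
Proof.
move=> [/eqP ij [x [y [sx sy CA BC]]]] /eqP i2 /eqP j2 iA iB.
have BA : B - A = x *: delta_mx 0 i + y *: delta_mx 0 j.
  by rewrite -CA -BC; vec_ring.
have [a [b [sa sb {}BA]]] : exists a b,
    [/\ is_sign a, is_sign b &
    B - A = a *: delta_mx 0 ord_x + b *: delta_mx 0 ord_y].
  move: i j ij i2 j2 BA {CA BC}; apply: coordP => //; apply: coordP => // _ _ _ ->.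
    by exists x, y.
  by exists y, x; split=> //; rewrite addrC.
have sab : is_sign (- (a * b)).
  by case: sa sb => -> [] ->; rewrite ?mulrN1 ?mulNr ?mul1r ?opprK;
    [right|left|left|right].
exists (- (a * b)) => //; apply: shear_edge => //.
rewrite BA /=; case: sa sb => -> [] ->.
- exists (vec3 (1 / 2) (Num.sqrt 3 / 2) 0); first by rewrite !inE eqxx ?orbT.
  by left; apply/rowP; apply: coordP; rewrite !mxE /=; field.
- exists (vec3 (1 / 2) (Num.sqrt 3 / 2) 0 - vec3 1 0 0).
    by rewrite !inE eqxx ?orbT.
  by right; apply/rowP; apply: coordP; rewrite !mxE /=; field.
- exists (vec3 (1 / 2) (Num.sqrt 3 / 2) 0 - vec3 1 0 0).
    by rewrite !inE eqxx ?orbT.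
  by left; apply/rowP; apply: coordP; rewrite !mxE /=; field.
- exists (vec3 (1 / 2) (Num.sqrt 3 / 2) 0); first by rewrite !inE eqxx ?orbT.
  by right; apply/rowP; apply: coordP; rewrite !mxE /=; field.
Qed.

(** Cutting off a corner saves one edge, at the price of an edge that is a
    diagonal of a unit square; the shear turns this diagonal into an edge of the
    hexagonal lattice, and all other edges as well. *)
Lemma shorter_sh_polygon s : lattice_polygon (cubic_lattice R) s ->
  exists s', [/\ lattice_polygon (sh_lattice R) s',
    ambient_isotopic (carrier s) (carrier s') & (size s' < size s)%N].
Proof.
move=> /horizontal_corner[A [C [B [r [i [j [cor [i2 j2] Ls sz iso]]]]]]].
have rn : r <> [::].
  by move=> r0; rewrite r0 in Ls; exact: corner_not_triangle cor Ls.
have [ss iso'] := triangle_remove rn Ls.1 (corner_independent cor)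
  (corner_triangle cor Ls).
have /lattice_polygonP[_ /= /and3P[]] := Ls.
move=> /asboolP/cubic_edgeP[iA _ _] /asboolP/cubic_edgeP[_ iB _] eB.
have [k sk eAB] := shear_corner cor i2 j2 iA iB.
have [ss' iso''] := linear_motion (shear_linear k) (@shear_motion k) ss.
exists (map (shear k) (A :: B :: r)); split.
- apply/lattice_polygonP; split=> //; rewrite cycle_map /=.
  apply/andP; split; first exact/asboolP.
  by apply: sub_path eB => a b /asboolP ab; apply/asboolP/shear_cubic_edge.
- apply: ambient_isotopic_trans iso''; exact: ambient_isotopic_trans iso'.
by rewrite -sz /= size_map.
Qed.

End Shortening.

Lemma min_edge_length_exists (R : realType) (L : lattice R)
    (T : set (set 'rV[R]_3)) (n : nat) : edge_lengths L T n ->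
  exists2 m, min_edge_length L T m & (m <= n)%N.
Proof.
move=> Ln; have exL : exists m, `[< edge_lengths L T m >].
  by exists n; apply/asboolP.
exists (ex_minn exL); case: ex_minnP => m /asboolP Lm mP.
  by split=> // k Lk; apply: mP; apply/asboolP.
by apply: mP; apply/asboolP.
Qed.

Theorem theorem4p9 (R : realType) (K : set 'rV[R]_3) (tameK : tame_knot K) :
  exists e_sh e_L : nat,
    [/\ min_edge_length (sh_lattice R) (knot_type K) e_sh,
        min_edge_length (cubic_lattice R) (knot_type K) e_L
      & (e_sh < e_L)%N].
Proof.
have [s [ss Ks]] := tameK.
have [c [Lc sc]] := cubic_polygon_isotopic ss.
have [e_L minL _] : exists2 m,
    min_edge_length (cubic_lattice R) (knot_type K) m & (m <= size c)%N.
  apply: min_edge_length_exists; exists c; split=> //.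
  exact: ambient_isotopic_trans sc.
have [[c' [Lc' Kc' szc']] _] := minL.
have [s' [Ls' cs' szs']] := shorter_sh_polygon Lc'.
have [e_sh minsh le_sh] : exists2 m,
    min_edge_length (sh_lattice R) (knot_type K) m & (m <= size s')%N.
  apply: min_edge_length_exists; exists s'; split=> //.
  exact: ambient_isotopic_trans cs'.
by exists e_sh, e_L; split=> //; rewrite -szc'; apply: leq_ltn_trans szs'.
Qed.
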